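(* Let $N\ge 2$ and $\varepsilon>0$, and let the payoff processes $(X^{i,I}_t)_{t\in\bar{\mathbf N}}$, $i\in\mathcal J$, $I\in\mathcal P$, satisfy the standing assumptions, including Assumption (A). Let $(\tau_n)_{n\ge1}$ be the sequence of stopping times produced by the scheme described in the context, and set $T_i^*:=\lim_{n\to\infty}\tau_{Nn+i}$ for $i=1,\dots,N$. Then the $N$-tuple $(T_i^* )_{i=1,\dots,N}$ is an $\varepsilon$-Nash equilibrium point for the nonzero-sum Dynkin game with payoffs $(J_i)_{i=1,\dots,N}$, i.e. for every $i\in\{1,\dots,N\}$ and every $T\in\mathcal T_0$, $$\mathbf E[J_i(T_1^*,\dots,T_{i-1}^*,T,T_{i+1}^*,\dots,T_N^* )]\le \mathbf E[J_i(T_1^*,\dots,T_N^* )]+\varepsilon .$$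
   Context: Setting. $\mathbf N=\{0,1,2,\dots\}$, $\bar{\mathbf N}=\mathbf N\cup\{\infty\}$. $(\Omega,\mathcal F,\mathbf P)$ is a probability space with a filtration $\mathbf F=(\mathcal F_t)_{t\in\mathbf N}$, and $\mathcal F_\infty:=\mathcal F=\bigvee_{t\ge0}\mathcal F_t$. Stopping times are $\bar{\mathbf N}$-valued; for a stopping time $\theta$, $\mathcal T_\theta$ is the set of $\mathbf F$-stopping times $\tau\ge\theta$. $\mathcal J=\{1,\dots,N\}$ and $\mathcal P$ is the set of nonempty subsets of $\mathcal J$. For $i\in\mathcal J$, $I\in\mathcal P$, $(X^{i,I}_t)_{t\in\bar{\mathbf N}}$ is a real-valued $\mathbf F$-adapted process with $\mathbf E[\sup_{t\in\bar{\mathbf N}}|X^{i,I}_t|]<\infty$. Assumption (A): for all $i,j\in\{1,\dots,N\}$ and all $t\in\mathbf N$, $X_t^{i,\{i,j\}}\le X_t^{i,\{j\}}$ $\mathbf P$-a.s. Payoffs. For $T_1,\dots,T_N\in\mathcal T_0$ and $R:=T_1\wedge\dots\wedge T_N$, $$J_i(T_1,\dots,T_N):=\sum_{I\in\mathcal P}X^{i,I}_R\,1_{\bigcap_{j\in I}\{T_j=R\}\cap\bigcap_{j\in I^c}\{T_j>R\}},$$ where $I^c=\mathcal J\setminus I$ and an empty intersection of events is $\Omega$. Scheme. For $n\ge1$ let $(q_n,i_n)$ be the unique pair of integers with $n=Nq_n+i_n$, $i_n\in\{1,\dots,N\}$. Set $\tau_1=\dots=\tau_N=\infty$, and for $n\ge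 N+1$ define inductively: (a) $\theta_n=\min\{\tau_{n-1},\dots,\tau_{n-(N-1)}\}$; (b) $I_n=\{i_l\in\mathcal J: n-N+1\le l\le n-1,\ \tau_l=\theta_n\}$; (c) for $t\in\bar{\mathbf N}$, $U^n_t=X^{i_n,\{i_n\}}_t1_{\{t<\theta_n\}}+Y^n1_{\{t\ge\theta_n\}}$, where $Y^n=\big(X^{i_n,I_n\cup\{i_n\}}_{\theta_n}\vee X^{i_n,I_n}_{\theta_n}\big)1_{\{\theta_n<\infty\}}+X^{i_n,\mathcal J}_\infty1_{\{\theta_n=\infty\}}$; (d) for $t\in\bar{\mathbf N}$, $W^n_t=\operatorname{ess\,sup}_{\nu\in\mathcal T_t}\mathbf E[U^n_\nu\mid\mathcal F_t]$; (e) $\mu_n=\min\{s\in\bar{\mathbf N}: W^n_s\le U^n_s+\varepsilon\}$; (f) $\tau_n=\mu_n\wedge\tau_{n-N}$ on $\{\mu_n\wedge\tau_{n-N}<\theta_n\}$, and $\tau_n=\tau_{n-N}$ on $\{\mu_n\wedge\tau_{n-N}\ge\theta_n\}$. For each $i$ the sequence $(\tau_{Nn+i})_{n\ge0}$ is non-increasing, so its limit exists. *)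

(* Defs.v *)
(* Library world: MathComp with MathComp-Analysis. *)
From HB Require Import structures.
From mathcomp Require Import all_boot all_order all_algebra.
From mathcomp Require Import all_classical all_reals all_analysis.
From mathcomp Require Import measurable_realfun.

Set Implicit Arguments.
Unset Strict Implicit.
Unset Printing Implicit Defensive.

Import Order.TTheory GRing.Theory Num.Theory.
Import numFieldNormedType.Exports.

Local Open Scope classical_set_scope.
Local Open Scope ring_scope.

(* The time set {0, 1, 2, ...} with infinity added, with its usual total order. *)
Variant xnat : Type := Fin of nat | Infty.

Definition option_of_xnat (t : xnat) : option nat :=
  if t is Fin n then Some n else None.
Definition xnat_of_option (o : option nat) : xnat :=
  if o is Some n then Fin n else Infty.
Lemma option_of_xnatK : cancel option_of_xnat xnat_of_option.
Proof. by case. Qed.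

HB.instance Definition _ := Choice.copy xnat (can_type option_of_xnatK).

Definition lex (s t : xnat) : bool :=
  match s, t with
  | _, Infty => true
  | Infty, Fin _ => false
  | Fin m, Fin n => (m <= n)%N
  end.
Definition ltx (s t : xnat) : bool := (t != s) && lex s t.

Lemma lex_anti : antisymmetric lex.
Proof. by case=> [m|] [n|] //= /anti_leq ->. Qed.
Lemma lex_trans : transitive lex.
Proof. by case=> [n|] [m|] [p|] //=; apply: leq_trans. Qed.
Lemma lex_total : total lex.
Proof. by case=> [m|] [n|] //=; apply: leq_total. Qed.

Fact xnat_display : Order.disp_t. Proof. exact: Order.Disp tt tt. Qed.

HB.instance Definition _ := Order.isOrder.Build xnat_display xnat
  (fun _ _ => erefl) (fun _ _ => erefl) (fun _ _ => erefl)
  lex_anti lex_trans lex_total.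

HB.instance Definition _ := isPointed.Build xnat Infty.
HB.instance Definition _ := OrderTopological.copy xnat (order_topology xnat).

(* The least element of A, with the convention that it is Infty when A is empty.
   Below this convention matters only on null sets: W_oo = U_oo almost surely. *)
Definition xmin (A : set xnat) : xnat :=
  if pselect (exists n : nat, `[< A (Fin n) >]) is left exA
  then Fin (ex_minn exA) else Infty.

Section Probability.
Context {d : measure_display} {Omega : measurableType d} {R : realType}.
Variable P : probability Omega R.
Implicit Types (G : set (set Omega)) (F : nat -> set (set Omega)).

Definition measurable_wrt {d'} {V : measurableType d'} G (f : Omega -> V) :=
  forall B, measurable B -> G (f @^-1` B).

Record is_filtration F : Prop := IsFiltration {
  filtration_sigma_algebra : forall n, sigma_algebra setT (F n);
  filtration_nondecreasing : forall m n, (m <= n)%N -> F m `<=` F n;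
  filtration_generates : @measurable d Omega = <<s \bigcup_n F n >> }.

Definition sigma_at F (t : xnat) : set (set Omega) :=
  if t is Fin n then F n else measurable.

Definition adapted {d'} {V : measurableType d'} F (Z : xnat -> Omega -> V) :=
  forall t, measurable_wrt (sigma_at F t) (Z t).

Definition stopping_time F (nu : Omega -> xnat) :=
  forall n : nat, F n [set w | (nu w <= Fin n)%O].

Definition stopping_times_from F (t : xnat) : set (Omega -> xnat) :=
  [set nu | stopping_time F nu /\ forall w, (t <= nu w)%O].

(* Z is a version of the conditional expectation of the integrable X given G. *)
Definition is_cond_exp G (X Z : Omega -> R) : Prop :=
  [/\ measurable_wrt G Z,
      P.-integrable setT (EFin \o Z) &
      forall A, G A ->
        (\int[P]_(w in A) (Z w)%:E = \int[P]_(w in A) (X w)%:E)%E].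

(* W is a version of the essential supremum of the family Phi. *)
Definition is_ess_sup (Phi : set (Omega -> R)) (W : Omega -> \bar R) : Prop :=
  [/\ measurable_fun setT W,
      forall Z, Phi Z -> {ae P, forall w, ((Z w)%:E <= W w)%E} &
      forall W' : Omega -> \bar R, measurable_fun setT W' ->
        (forall Z, Phi Z -> {ae P, forall w, ((Z w)%:E <= W' w)%E}) ->
        {ae P, forall w, (W w <= W' w)%E}].

(* W is an adapted version of t |-> esssup_{nu >= t} E[U_nu | F_t]. *)
Definition is_snell_envelope F (U : xnat -> Omega -> R)
    (W : xnat -> Omega -> \bar R) : Prop :=
  adapted F W /\
  forall t, is_ess_sup
    [set Z | exists2 nu, stopping_times_from F t nu &
       is_cond_exp (sigma_at F t) (fun w => U (nu w) w) Z] (W t).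

Section Game.
Variable N : nat.

(* X i I t w is the reward of player i when I is the set of players who stop;
   only nonempty I are meaningful, X i set0 is never used. Players are numbered
   from 0: the ordinal i : 'I_N is the player usually numbered i.+1. *)
Variable X : 'I_N -> {set 'I_N} -> xnat -> Omega -> R.
Implicit Types (i j : 'I_N) (I : {set 'I_N}).

Definition payoff_process F (Z : xnat -> Omega -> R) : Prop :=
  adapted F Z /\
  (\int[P]_w ereal_sup (range (fun t => `|Z t w|%:E)) < +oo)%E.

Definition assumption_A : Prop :=
  forall i j (n : nat),
    {ae P, forall w, X i [set i; j]%SET (Fin n) w <= X i [set j]%SET (Fin n) w}.

Definition first_stop (S : 'I_N -> Omega -> xnat) (w : Omega) : xnat :=
  \big[Order.min/Infty]_(j < N) S j w.

Definition stopped_by (S : 'I_N -> Omega -> xnat) I : set Omega :=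
  (\bigcap_(j in [set` I]) [set w | S j w = first_stop S w]) `&`
  (\bigcap_(j in [set` (~: I)%SET]) [set w | (first_stop S w < S j w)%O]).

Definition payoff (S : 'I_N -> Omega -> xnat) i (w : Omega) : R :=
  \sum_(I : {set 'I_N} | I != finset.set0)
    X i I (first_stop S w) w * \1_(stopped_by S I) w.

Definition deviate (S : 'I_N -> Omega -> xnat) i (T : Omega -> xnat) :=
  fun j => if j == i then T else S j.

Definition is_eps_Nash F (eps : R) (S : 'I_N -> Omega -> xnat) : Prop :=
  (forall i, stopping_time F (S i)) /\
  (forall i (T : Omega -> xnat), stopping_time F T ->
    ('E_P[payoff (deviate S i T) i] <= 'E_P[payoff S i] + eps%:E)%E).

(* Player j is the one whose stopping time is revised at step n. *)
Definition turn (n : nat) j : Prop := exists q : nat, n = (N * q + j.+1)%N.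

Section Scheme.
Variable tau : nat -> Omega -> xnat.

Definition theta (n : nat) (w : Omega) : xnat :=
  \big[Order.min/Infty]_(1 <= k < N) tau (n - k)%N w.

Definition first_set (n : nat) (w : Omega) : {set 'I_N} :=
  [set j : 'I_N | `[< exists l : nat,
     [/\ (n - N + 1 <= l <= n - 1)%N, turn l j & tau l w = theta n w] >]]%SET.

Definition scheme_Y (n : nat) i (w : Omega) : R :=
  let I := first_set n w in
  if (theta n w < Infty)%O
  then Num.max (X i (I :|: [set i])%SET (theta n w) w) (X i I (theta n w) w)
  else X i [set: 'I_N]%SET Infty w.

Definition scheme_U (n : nat) i (t : xnat) (w : Omega) : R :=
  if (t < theta n w)%O then X i [set i]%SET t w else scheme_Y n i w.

Definition scheme_mu (eps : R) (W : nat -> xnat -> Omega -> \bar R)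
    (n : nat) i (w : Omega) : xnat :=
  xmin [set s | (W n s w <= (scheme_U n i s w + eps)%:E)%E].

(* The essential suprema W n t are defined only up to null sets, so the scheme
   is a relation between tau and a choice W of adapted versions. The entries
   tau 0 and W n for n <= N play no role. *)
Definition scheme F (eps : R) (W : nat -> xnat -> Omega -> \bar R) : Prop :=
  (forall n w, (1 <= n <= N)%N -> tau n w = Infty) /\
  (forall n i, (N + 1 <= n)%N -> turn n i ->
    is_snell_envelope F (scheme_U n i) (W n) /\
    forall w, tau n w =
      let m := Order.min (scheme_mu eps W n i w) (tau (n - N)%N w) in
      if (m < theta n w)%O then m else tau (n - N)%N w).

Definition limit_time i (w : Omega) : xnat :=
  lim ((tau (N * n + i.+1)%N w) @[n --> \oo]).

End Scheme.
End Game.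
End Probability.

(* Main.v *)
Require Import Defs.
From HB Require Import structures.
From mathcomp Require Import all_boot all_order all_algebra.
From mathcomp Require Import all_classical all_reals all_analysis.
From mathcomp Require Import measurable_realfun.
From mathcomp Require Import zify lra.

Set Implicit Arguments.
Unset Strict Implicit.
Unset Printing Implicit Defensive.

Import Order.TTheory GRing.Theory Num.Theory.
Import numFieldNormedType.Exports.

Local Open Scope classical_set_scope.
Local Open Scope ring_scope.

(** Consider the step at which player [i] moves, and let [U] be its reward
    process there. Until the earliest stopping time [theta] of the others, [U]
    is what stopping alone pays; from then on it is the larger of what stopping
    with the first stoppers and what letting them stop pay (if [theta] is
    infinite, the reward of the whole set of players at infinity). Whatever time
    [T] the player chooses, its payoff is at most [U] at [T]
    ([deviation_payoff_le]). The new stopping time of the player attains [U]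
    ([profile_payoffE]): new values are strictly below the stopping times of the
    others, so two players never stop together at a finite time
    ([tau_distinct]); the first stopper is then a single player [j], and
    Assumption (A) says that letting [j] stop pays at least as much as stopping
    with [j]. It thus suffices that the player's candidate, the minimum of [mu]
    and of its previous stopping time, is [eps]-optimal for the optimal stopping
    of [U]; the mover then plays an [eps]-best response
    ([mover_best_response]).

    Optimality up to [eps] is a general fact ([eps_optimal_stopping]) about a
    stopping time [sigma] that never stops where waiting could gain more than
    [eps] and never passes a time where the Snell envelope is within [eps] of
    [U]. Take a [delta]-optimal [nu]. Where [nu < sigma] the envelope exceeds
    [U] by more than [eps] at time [nu], and an exhaustion argument lets one
    gain [eps] on almost all of that event, so its probability is at most
    [delta / eps] ([early_stop_bound]). Where [sigma <= nu] the gain of [nu]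
    over [sigma] is at most [eps]. Letting [delta] tend to [0] and using the
    absolute continuity of the integral of a dominating function gives the
    claim; no convergence of the envelope at infinity is needed.

    The candidate has these properties ([candidate_stop]). The delicate case is
    that of a previous stopping time coming before both [mu] and [theta]: then
    none of the other players has moved since the preceding move of [i], as
    moving would have brought [theta] down, so the rewards are those of that
    move ([scheme_U_unmoved]) and induction applies.

    Finally each player's stopping times are nonincreasing in discrete time,
    hence eventually constant at every outcome, and dominated convergence
    carries the inequality to the limit ([payoff_cvg]). *)

(** * Conditional expectations and sub-sigma-algebras *)

Section SubSigmaAlgebra.
Context {d : measure_display} {Omega : measurableType d} {R : realType}.
Variable P : probability Omega R.
Implicit Types (G : set (set Omega)) (A B : set Omega).

Lemma sigma_algebra_setC G A : sigma_algebra setT G -> G A -> G (~` A).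
Proof. by case=> _ + _ GA => /(_ _ GA); rewrite setTD. Qed.

Lemma sigma_algebra_setT G : sigma_algebra setT G -> G setT.
Proof.
by move=> sG; rewrite -setC0; apply: sigma_algebra_setC => //; case: sG.
Qed.

Lemma sigma_algebra_setU G A B :
  sigma_algebra setT G -> G A -> G B -> G (A `|` B).
Proof.
move=> [G0 _ GU] GA GB; rewrite -bigcup2E; apply: GU => k.
by rewrite /bigcup2; case: k => [|[|k]].
Qed.

Lemma sigma_algebra_setI G A B :
  sigma_algebra setT G -> G A -> G B -> G (A `&` B).
Proof.
move=> sG GA GB; rewrite -[A `&` B]setCK setCI; apply: sigma_algebra_setC => //.
by apply: sigma_algebra_setU => //; apply: sigma_algebra_setC.
Qed.

Lemma sigma_algebra_setD G A B :
  sigma_algebra setT G -> G A -> G B -> G (A `\` B).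
Proof.
move=> sG GA GB; rewrite setDE; apply: sigma_algebra_setI => //.
exact: sigma_algebra_setC.
Qed.

Lemma sigma_algebra_bigcupW G (D : set nat) (A : nat -> set Omega) :
  sigma_algebra setT G -> (forall k, D k -> G (A k)) -> G (\bigcup_(k in D) A k).
Proof.
move=> sG GA; rewrite bigcup_mkcond; case: (sG) => [G0 _]; apply => k.
by case: ifPn => [/set_mem|_] //; exact: GA.
Qed.

(** Measurability with respect to [G] is measurability on the space [Omega]
    equipped with the sigma-algebra [G]. *)
Lemma measurable_wrtP {d'} {V : measurableType d'} G (f : Omega -> V) :
  sigma_algebra setT G ->
  measurable_wrt G f <-> @measurable_fun _ _ (g_sigma_algebraType G) V setT f.
Proof.
move=> sG; have GE := measurable_g_measurableTypeE sG; split=> mf.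
- by move=> _ B mB; rewrite setTI; have := mf B mB; rewrite -{1}GE.
- move=> B mB; have := mf (@measurableT _ (g_sigma_algebraType G)) B mB.
  by rewrite setTI GE.
Qed.

Lemma measurable_wrt_fun {d'} {V : measurableType d'} G (f : Omega -> V) :
  G `<=` measurable -> measurable_wrt G f -> measurable_fun setT f.
Proof. by move=> Gm mf _ B mB; rewrite setTI; apply/Gm/mf. Qed.

Lemma measurable_wrt_ltr G (f1 f2 : Omega -> R) : sigma_algebra setT G ->
    measurable_wrt G f1 -> measurable_wrt G f2 -> G [set w | f1 w < f2 w].
Proof.
move=> sG /(measurable_wrtP _ sG) m1 /(measurable_wrtP _ sG) m2.
rewrite -(measurable_g_measurableTypeE sG).
rewrite -[X in measurable X]setTI.
by apply: (measurable_fun_ltr m1 m2 measurableT (Y := [set true])).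
Qed.

Lemma measurable_wrt_lee G (f1 f2 : Omega -> \bar R) : sigma_algebra setT G ->
    measurable_wrt G f1 -> measurable_wrt G f2 -> G [set w | (f1 w <= f2 w)%E].
Proof.
move=> sG /(measurable_wrtP _ sG) m1 /(measurable_wrtP _ sG) m2.
rewrite -(measurable_g_measurableTypeE sG).
rewrite -[X in measurable X]setTI; exact: measurable_lee.
Qed.

(** The conditional expectation is the Radon-Nikodym derivative, on the space
    equipped with [G], of the charge with density [X] with respect to [P]. *)
Lemma cond_exp_exists G (X : Omega -> R) :
    sigma_algebra setT G -> G `<=` measurable ->
    P.-integrable setT (EFin \o X) ->
  exists Z, is_cond_exp P G X Z.
Proof.
move=> sG Gm iX; pose T' := g_sigma_algebraType G.
have GE : @measurable _ T' = G := measurable_g_measurableTypeE sG.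
pose phi : Omega -> T' := id.
have mphi : measurable_fun setT phi.
  by move=> _ B mB; rewrite setTI; apply: Gm; rewrite -GE.
pose mphi_mixin := isMeasurableFun.Build _ _ _ _ _ mphi.
pose phi' : {mfun Omega >-> T'} :=
  MeasurableFun.Pack (MeasurableFun.Class mphi_mixin).
pose mu : probability T' R := distribution P phi'.
pose ch : {charge set Omega -> \bar R} := induced_charge iX.
have ch0 : (ch : set T' -> \bar R) set0 = 0%E by exact: charge0.
have chfin : fin_num_fun (ch : set T' -> \bar R).
  by move=> A mA; apply: fin_num_measure; apply: Gm; rewrite -GE.
have chadd : semi_sigma_additive (ch : set T' -> \bar R).
  move=> A mA tA mUA; apply: charge_semi_sigma_additive => //.
    by move=> n; apply: Gm; rewrite -GE.
  by apply: Gm; rewrite -GE.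
pose nu : {charge set T' -> \bar R} :=
  HB.pack (ch : set T' -> \bar R)
    (isCharge.Build _ T' R (ch : set T' -> \bar R) ch0 chfin chadd).
have numu : nu `<< mu.
  apply/null_content_dominatesP => A mA muA0.
  have mA' : measurable (A : set Omega) by apply: Gm; rewrite -GE.
  apply: null_set_integral => //; apply: measurable_funTS.
  exact: measurable_int iX.
pose f := Radon_Nikodym nu mu.
have ifmu : mu.-integrable setT f by exact: Radon_Nikodym_integrable.
have mf : measurable_fun setT f by exact: measurable_int ifmu.
have fE x : (fine (f x))%:E = f x by rewrite fineK// Radon_Nikodym_fin_num.
have mfine : @measurable_fun _ _ T' R setT (fine \o f).
  exact: measurableT_comp.
have iP : P.-integrable setT (EFin \o (fine \o f : Omega -> R)).
  have -> : EFin \o (fine \o f) = f :> (Omega -> \bar R).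
    by apply/funext => x /=.
  apply/integrableP; split.
    move=> _ B mB; rewrite setTI; apply: Gm.
    by rewrite -GE -[X in measurable X]setTI; exact: mf.
  case/integrableP : ifmu => _; rewrite ge0_integral_pushforward//.
  exact: measurableT_comp.
exists (fine \o f); split => //; first exact/measurable_wrtP.
move=> A GA; have mA : measurable (A : set T') by rewrite GE.
have <- : nu A = (\int[P]_(x in A) (X x)%:E)%E by [].
rewrite (Radon_Nikodym_integral numu mA).
have -> : (\int[mu]_(x in A) f x = \int[P]_(x in phi' @^-1` A) (f \o phi') x)%E.
  apply: integral_pushforward => //.
  apply: (integrableS measurableT) => //; first exact: Gm.
  by apply: eq_integrable iP => // x _ /=.
by apply: eq_integral => x _ /=.
Qed.

End SubSigmaAlgebra.

(** * Stopping times *)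

Lemma le_Fin m n : (Fin m <= Fin n)%O = (m <= n)%N. Proof. by []. Qed.

Lemma le_Infty (t : xnat) : (t <= Infty)%O. Proof. by case: t. Qed.

Lemma lt_Infty (t : xnat) : (t < Infty)%O = (t != Infty).
Proof. by rewrite lt_neqAle le_Infty andbT. Qed.

Section StoppingTimes.
Context {d : measure_display} {Omega : measurableType d} {R : realType}.
Variables (P : probability Omega R) (F : nat -> set (set Omega)).
Hypothesis hF : is_filtration F.
Implicit Types (nu : Omega -> xnat) (A B : set Omega).

Lemma sigma_atP (t : xnat) : sigma_algebra setT (sigma_at F t).
Proof.
case: t => [n|]; first exact: filtration_sigma_algebra.
exact: sigma_algebra_measurable.
Qed.

Lemma sigma_at_measurable (t : xnat) : sigma_at F t `<=` measurable.
Proof.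
case: t => [n|] //= A FA; rewrite (filtration_generates hF).
by apply: sub_sigma_algebra; exists n.
Qed.

Lemma sigma_at_le (s t : xnat) :
  (s <= t)%O -> sigma_at F s `<=` sigma_at F t.
Proof.
case: t => [n|]; last by move=> _; exact: sigma_at_measurable.
by case: s => [m|] //; exact: filtration_nondecreasing.
Qed.

Lemma sigma_at_bool (t : xnat) (b : bool) : sigma_at F t [set _ | b].
Proof.
have sG := sigma_atP t; case: b.
  have -> : [set _ : Omega | true] = setT by apply/seteqP; split.
  exact: sigma_algebra_setT.
have -> : [set _ : Omega | false] = set0 by apply/seteqP; split.
by case: sG.
Qed.

Lemma stopping_le nu (t : xnat) :
  stopping_time F nu -> sigma_at F t [set w | (nu w <= t)%O].
Proof.
case: t => [n|] snu; first exact: snu.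
rewrite (_ : [set _ | _] = setT); last first.
  by apply/seteqP; split=> // w _; exact: le_Infty.
exact: sigma_algebra_setT (sigma_atP Infty).
Qed.

Lemma stopping_gt nu (t : xnat) :
  stopping_time F nu -> sigma_at F t [set w | (t < nu w)%O].
Proof.
move=> snu; rewrite (_ : [set _ | _] = ~` [set w | (nu w <= t)%O]).
  by apply: sigma_algebra_setC; [exact: sigma_atP|exact: stopping_le].
by apply/seteqP; split=> w /=; rewrite ltNge => /negP.
Qed.

Lemma stopping_eq nu (t : xnat) :
  stopping_time F nu -> sigma_at F t [set w | nu w = t].
Proof.
move=> snu; have sG := sigma_atP t.
have -> : [set w | nu w = t] =
    [set w | (nu w <= t)%O] `\` [set w | (nu w < t)%O].
  apply/seteqP; split=> w /=; first by move=> ->; rewrite lexx ltxx.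
  by case=> le /negP; rewrite -leNgt => ge; apply/eqP; rewrite eq_le le ge.
apply: sigma_algebra_setD => //; first exact: stopping_le.
have -> : [set w | (nu w < t)%O] =
    \bigcup_(n in [set n | (Fin n < t)%O]) [set w | (nu w <= Fin n)%O].
  apply/seteqP; split=> w /=.
    move=> h; have : nu w != Infty.
      by apply/eqP => e; move: h; rewrite e ltNge le_Infty.
    by case e: (nu w) => [m|] // _; exists m; rewrite /= ?e// -e.
  by case=> n /= nt /le_lt_trans; apply.
apply: sigma_algebra_bigcupW => // n /= nt.
exact: (sigma_at_le (ltW nt)) (snu n).
Qed.

Lemma stopping_cst (t : xnat) : stopping_time F (fun=> t).
Proof. by move=> n; exact: (sigma_at_bool (Fin n)). Qed.

Lemma stopping_min nu1 nu2 : stopping_time F nu1 -> stopping_time F nu2 ->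
  stopping_time F (fun w => Order.min (nu1 w) (nu2 w)).
Proof.
move=> s1 s2 n; rewrite (_ : [set _ | _] =
  [set w | (nu1 w <= Fin n)%O] `|` [set w | (nu2 w <= Fin n)%O]).
  exact: (sigma_algebra_setU (sigma_atP (Fin n))).
by apply/seteqP; split=> w /=; rewrite ge_min => /orP.
Qed.

Lemma stopping_max nu1 nu2 : stopping_time F nu1 -> stopping_time F nu2 ->
  stopping_time F (fun w => Order.max (nu1 w) (nu2 w)).
Proof.
move=> s1 s2 n; rewrite (_ : [set _ | _] =
  [set w | (nu1 w <= Fin n)%O] `&` [set w | (nu2 w <= Fin n)%O]).
  exact: (sigma_algebra_setI (sigma_atP (Fin n))).
by apply/seteqP; split=> w /=; rewrite ge_max => /andP.
Qed.

(** The events known at the stopping time [nu]. *)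
Definition known_at nu A : Prop :=
  forall t, sigma_at F t (A `&` [set w | nu w = t]).

Lemma known_at_measurable nu A : known_at nu A -> measurable A.
Proof.
move=> kA; rewrite (_ : A = (A `&` [set w | nu w = Infty]) `|`
    \bigcup_n (A `&` [set w | nu w = Fin n])).
  apply: measurableU; first exact: (kA Infty).
  by apply: bigcupT_measurable => n; apply: sigma_at_measurable (kA (Fin n)).
apply/seteqP; split=> w /=; last by case=> [[]|[n _ []]].
by move=> Aw; case e: (nu w) => [n|]; [right; exists n|left].
Qed.

Lemma known_atU nu A B :
  known_at nu A -> known_at nu B -> known_at nu (A `|` B).
Proof.
move=> kA kB t; rewrite setIUl.
by apply: sigma_algebra_setU => //; exact: sigma_atP.
Qed.

Lemma known_atI nu A B :
  known_at nu A -> known_at nu B -> known_at nu (A `&` B).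
Proof.
move=> kA kB t; rewrite setIIl.
by apply: sigma_algebra_setI => //; exact: sigma_atP.
Qed.

Lemma known_atD nu A B :
  known_at nu A -> known_at nu B -> known_at nu (A `\` B).
Proof.
move=> kA kB t; rewrite (_ : _ `&` _ =
  (A `&` [set w | nu w = t]) `\` (B `&` [set w | nu w = t])).
  by apply: sigma_algebra_setD => //; exact: sigma_atP.
apply/seteqP; split=> w /=; first by case=> -[? nB] ?; split=> // -[].
by case=> -[? ?] nB; split=> //; split=> // ?; apply: nB.
Qed.

Lemma known_at_bigcup nu (A : nat -> set Omega) :
  (forall k, known_at nu (A k)) -> known_at nu (\bigcup_k A k).
Proof.
move=> kA t; rewrite setI_bigcupl.
by apply: sigma_algebra_bigcupW => [|k _]; [exact: sigma_atP|exact: kA].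
Qed.

Lemma known_at_lt nu1 nu2 : stopping_time F nu1 -> stopping_time F nu2 ->
  known_at nu1 [set w | (nu1 w < nu2 w)%O].
Proof.
move=> s1 s2 t; rewrite (_ : _ `&` _ =
  [set w | (t < nu2 w)%O] `&` [set w | nu1 w = t]).
  apply: (sigma_algebra_setI (sigma_atP t)); first exact: stopping_gt.
  exact: stopping_eq.
by apply/seteqP; split=> w /= -[h e]; split=> //=; move: h; rewrite e.
Qed.

(** Gluing two stopping times along an event known beforehand. *)
Lemma stopping_glue nu nu1 nu2 B :
    stopping_time F nu -> stopping_time F nu1 -> stopping_time F nu2 ->
    (forall w, (nu w <= nu1 w)%O) -> (forall w, (nu w <= nu2 w)%O) ->
    known_at nu B ->
  stopping_time F (fun w => if w \in B then nu1 w else nu2 w).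
Proof.
move=> s s1 s2 le1 le2 kB n; have sG := filtration_sigma_algebra hF n.
pose K : set Omega := B `&` [set w | (nu w <= Fin n)%O].
have FK : F n K.
  rewrite (_ : K = \bigcup_(m in [set m | (m <= n)%N])
      (B `&` [set w | nu w = Fin m])).
    apply: sigma_algebra_bigcupW => // m /= mn.
    exact: (filtration_nondecreasing hF mn (kB (Fin m))).
  apply/seteqP; split=> w /=; last by case=> m mn [Bw /= e]; split=> //=; rewrite e.
  by case=> Bw /=; case e: (nu w) => [m|] // mn; exists m.
rewrite (_ : [set _ | _] = (K `&` [set w | (nu1 w <= Fin n)%O]) `|`
    ([set w | (nu2 w <= Fin n)%O] `\` K)).
  apply: sigma_algebra_setU => //.
    by apply: sigma_algebra_setI => //; exact: s1.
  by apply: sigma_algebra_setD => //; exact: s2.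
apply/seteqP; split=> w /=.
  case: ifPn => [/set_mem Bw h|/negP nB h]; [left|right].
    by split=> //; split=> //=; exact: le_trans h.
  by split=> // -[Bw _]; apply: nB; rewrite inE.
case=> [[[Bw _] h]|[h nK]]; first by rewrite mem_set.
case: ifPn => // /set_mem Bw; exfalso; apply: nK; split=> //=.
exact: le_trans h.
Qed.

(** A function defined by cases along a countable partition is measurable. *)
Lemma measurable_wrt_glue {d'} {V : measurableType d'} (G : set (set Omega))
    (K : countType) (k : Omega -> K) (h : K -> Omega -> V) :
    sigma_algebra setT G -> (forall x, G [set w | k w = x]) ->
    (forall x, measurable_wrt G (h x)) ->
  measurable_wrt G (fun w => h (k w) w).
Proof.
move=> sG Gk mh B mB.
rewrite (_ : _ @^-1` B = \bigcup_n
  (if unpickle n is Some x then [set w | k w = x] `&` h x @^-1` B else set0)).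
  apply: sigma_algebra_bigcupW => // n _.
  case: unpickle => [x|]; last by case: sG.
  by apply: sigma_algebra_setI => //; exact: mh.
apply/seteqP; split=> w /=.
  by move=> Bw; exists (pickle (k w)) => //; rewrite pickleK.
by case=> n _; case: unpickle => [x [/= ->]|].
Qed.

Lemma stopped_measurable {d'} {V : measurableType d'} (U : xnat -> Omega -> V)
    nu : adapted F U -> stopping_time F nu ->
  measurable_fun setT (fun w => U (nu w) w).
Proof.
move=> aU snu; apply: (@measurable_wrt_fun _ _ _ _ measurable) => //.
have -> : (fun w => U (nu w) w) =
    (fun w => (U \o xnat_of_option) (option_of_xnat (nu w)) w).
  by apply/funext => w /=; rewrite option_of_xnatK.
apply: (measurable_wrt_glue (K := option nat)).
- exact: sigma_algebra_measurable.
- move=> x; apply: (@sigma_at_measurable (xnat_of_option x)).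
  rewrite (_ : [set _ | _] = [set w | nu w = xnat_of_option x]).
    exact: stopping_eq.
  apply/seteqP; split=> w /= e; first by rewrite -e option_of_xnatK.
  by rewrite e; case: x {e}.
- by move=> x B mB; apply: sigma_at_measurable (aU (xnat_of_option x) B mB).
Qed.

End StoppingTimes.

(** * Optimal stopping *)

Section OptimalStopping.
Context {d : measure_display} {Omega : measurableType d} {R : realType}.
Variables (P : probability Omega R) (F : nat -> set (set Omega)).
Hypothesis hF : is_filtration F.
Variables (U : xnat -> Omega -> R) (g : Omega -> R).
Hypothesis aU : adapted F U.
Hypothesis ig : P.-integrable setT (EFin \o g).
Hypothesis Ug : {ae P, forall w, forall t, `|U t w| <= g w}.
Implicit Types (nu rho : Omega -> xnat) (A B : set Omega).

Lemma ae_le_Rintegral B (f1 f2 : Omega -> R) : measurable B ->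
    P.-integrable B (EFin \o f1) -> P.-integrable B (EFin \o f2) ->
    {ae P, forall w, B w -> f1 w <= f2 w} ->
  \int[P]_(w in B) f1 w <= \int[P]_(w in B) f2 w.
Proof.
move=> mB if1 if2 f12; rewrite -subr_ge0 -RintegralB//.
have mf : measurable_fun B (fun w => f2 w - f1 w).
  apply: measurable_funB; apply/measurable_EFinP.
    exact: measurable_int if2.
  exact: measurable_int if1.
rewrite /Rintegral (ae_eq_integral (fun w => `|f2 w - f1 w|%:E))//.
- by apply: fine_ge0; apply: integral_ge0 => w _; rewrite lee_fin.
- exact/measurable_EFinP.
- by apply/measurable_EFinP; exact: measurableT_comp.
- apply: filterS f12 => w le12 Bw.
  by rewrite ger0_norm// subr_ge0 le12.
Qed.

Notation stopped nu := (fun w => U (nu w) w).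
Notation pr A := (fine (P A)).

Lemma stopped_integrable nu :
  stopping_time F nu -> P.-integrable setT (EFin \o stopped nu).
Proof.
move=> snu; have mU := stopped_measurable hF aU snu.
apply/integrableP; split; first exact/measurable_EFinP.
case/integrableP: (ig) => mg; apply: le_lt_trans.
apply: ae_ge0_le_integral => //.
- by apply: measurableT_comp => //; exact/measurable_EFinP.
- exact: measurableT_comp.
- apply: filterS Ug => w /(_ (nu w)) Uw _ /=.
  by rewrite lee_fin (le_trans Uw)// ler_norm.
Qed.

Lemma stopped_integrableS nu A : stopping_time F nu -> measurable A ->
  P.-integrable A (EFin \o stopped nu).
Proof.
by move=> snu mA; apply: (integrableS measurableT) => //; exact: stopped_integrable.
Qed.

Lemma prE A : measurable A -> (pr A)%:E = P A.
Proof. by move=> mA; rewrite fineK// fin_num_measure. Qed.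

(** Where the Snell envelope is within [eps] of [U], no later stopping time
    gains more than [eps]. *)
Lemma snell_stop (s : xnat) (Ws : Omega -> \bar R) (eps : R) nu B :
    is_ess_sup P [set Z | exists2 nu, stopping_times_from F s nu &
       is_cond_exp P (sigma_at F s) (stopped nu) Z] Ws ->
    stopping_times_from F s nu -> sigma_at F s B ->
    (forall w, B w -> (Ws w <= (U s w + eps)%:E)%E) ->
  \int[P]_(w in B) U (nu w) w <= \int[P]_(w in B) U s w + eps * pr B.
Proof.
move=> [_ ub _] snu FB WB.
have mB : measurable B := sigma_at_measurable hF FB.
have [snu1 _] := snu.
have [Z ZE] := cond_exp_exists (sigma_atP hF s) (sigma_at_measurable hF (t := s))
  (stopped_integrable snu1).
have [_ iZ intZ] := ZE.
have iUs : P.-integrable B (EFin \o U s).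
  exact: (stopped_integrableS (stopping_cst hF s)).
have ic : P.-integrable B (EFin \o cst eps).
  by apply: finite_measure_integrable_cst.
have iUc : P.-integrable B (EFin \o (fun w => U s w + eps)).
  rewrite (_ : EFin \o _ = (EFin \o U s) \+ (EFin \o cst eps))//.
  exact: integrableD.
rewrite {1}/Rintegral -(intZ _ FB) -Rintegral_cst// -RintegralD//.
apply: ae_le_Rintegral => //; first exact: (integrableS measurableT).
have := ub Z (ex_intro2 _ _ nu snu ZE); apply: filterS => w ZW Bw.
by rewrite -lee_fin; exact: le_trans ZW (WB w Bw).
Qed.

(** Where the Snell envelope exceeds [U] by more than [eps], some later
    stopping time gains [eps] on a set of positive probability. *)
Lemma snell_continue (s : xnat) (Ws : Omega -> \bar R) (eps : R) A :
    is_ess_sup P [set Z | exists2 nu, stopping_times_from F s nu &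
       is_cond_exp P (sigma_at F s) (stopped nu) Z] Ws ->
    sigma_at F s A -> (forall w, A w -> ((U s w + eps)%:E < Ws w)%E) ->
    (0 < P A)%E ->
  exists B, [/\ sigma_at F s B, B `<=` A, (0 < P B)%E &
    exists2 nu, stopping_times_from F s nu &
      forall B', sigma_at F s B' -> B' `<=` B ->
      \int[P]_(w in B') U s w + eps * pr B' <= \int[P]_(w in B') U (nu w) w].
Proof.
move=> [mW _ least] FA AW PA.
have sG := sigma_atP hF s.
have mA : measurable A := sigma_at_measurable hF FA.
have mUs : measurable_fun setT (U s).
  exact: (measurable_wrt_fun (sigma_at_measurable hF (t := s)) (aU s)).
apply: contrapT => noB.
(* Otherwise every member of the family is at most [U s + eps] almost surely on
   [A], so that [W'] is an essential upper bound below [Ws] on [A]. *)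
pose W' w := if w \in A then (U s w + eps)%:E else +oo%E.
have mW' : measurable_fun setT W'.
  apply: measurable_fun_ifT => //.
    apply: (measurable_fun_bool true); rewrite setTI.
    have -> : (fun w => w \in A) @^-1` [set true] = A; last by [].
    by apply/seteqP; split=> w /=; [move/set_mem|move/mem_set].
  by apply/measurable_EFinP; apply: measurable_funD.
have WW' : {ae P, forall w, (Ws w <= W' w)%E}.
  apply: least => // Z [nu snu ZE]; have [mZ iZ intZ] := ZE.
  pose B := A `&` [set w | U s w + eps < Z w].
  have FB : sigma_at F s B.
    apply: sigma_algebra_setI => //.
    apply: measurable_wrt_ltr => //.
    by apply/(measurable_wrtP _ sG)/measurable_funD => //; exact/measurable_wrtP.
  have mB := sigma_at_measurable hF FB.
  have PB0 : P B = 0%E.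
    apply/eqP; rewrite eq_le measure_ge0 andbT leNgt; apply/negP => PB.
    apply: noB; exists B; split=> //; first by move=> w [].
    exists nu => // B' FB' B'B.
    have mB' := sigma_at_measurable hF FB'.
    have [snu1 _] := snu.
    have iUs : P.-integrable B' (EFin \o U s).
      exact: (stopped_integrableS (stopping_cst hF s)).
    have ic : P.-integrable B' (EFin \o cst eps).
      by apply: finite_measure_integrable_cst.
    rewrite [leRHS]/Rintegral -(intZ _ FB') -Rintegral_cst// -RintegralD//.
    apply: le_Rintegral => //.
    + rewrite (_ : EFin \o _ = (EFin \o U s) \+ (EFin \o cst eps))//.
      exact: integrableD.
    + exact: (integrableS measurableT).
    + by move=> w /B'B[_ /ltW].
  exists B; split=> // w /= nZ; apply: contrapT => nB; apply: nZ.
  rewrite /W'; case: ifPn => [/set_mem Aw|_]; last exact: leey.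
  by rewrite lee_fin leNgt; apply/negP => ZU; apply: nB; split.
have : P A = 0%E.
  case: WW' => D [mD PD subD].
  apply: (subset_measure0 mA mD) => // w Aw; apply: subD => /=.
  by rewrite /W' mem_set// leNgt AW.
by move=> PA0; rewrite PA0 ltxx in PA.
Qed.

(** An event [B] known at [nu], inside [A], after which some later stopping
    time gains [eps] over [nu] on every sub-event known at [nu]. *)
Definition improvable (eps : R) nu A B : Prop :=
  [/\ known_at F nu B, B `<=` A &
    exists rho, [/\ stopping_time F rho, forall w, (nu w <= rho w)%O &
      forall B', known_at F nu B' -> B' `<=` B ->
      \int[P]_(w in B') U (nu w) w + eps * pr B' <=
      \int[P]_(w in B') U (rho w) w]].

Lemma Rintegral_split (f : Omega -> R) A B :
    measurable A -> measurable B -> P.-integrable B (EFin \o f) ->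
  \int[P]_(w in B) f w = \int[P]_(w in B `&` A) f w + \int[P]_(w in B `\` A) f w.
Proof.
move=> mA mB fi; rewrite -{1}(setUIDK B A) Rintegral_setU //.
- exact: measurableI.
- exact: measurableD.
- by rewrite setUIDK.
- by apply/disj_setPS => w [[_ Aw] [_ /(_ Aw)]].
Qed.

Lemma pr_split A B : measurable A -> measurable B ->
  pr B = pr (B `&` A) + pr (B `\` A).
Proof.
move=> mA mB; rewrite -[LHS]mul1r -[X in X + _]mul1r -[X in _ + X]mul1r.
rewrite -!Rintegral_cst//; [|exact: measurableD|exact: measurableI].
by apply: Rintegral_split => //; exact: finite_measure_integrable_cst.
Qed.

Lemma improvable0 eps nu A : stopping_time F nu -> improvable eps nu A set0.
Proof.
move=> snu; split=> [t||] //.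
  by rewrite set0I; case: (sigma_atP hF t).
exists nu; split=> // B' _; rewrite subset0 => ->.
by rewrite measure0 mulr0 addr0.
Qed.

Lemma improvableU eps nu A B1 B2 : stopping_time F nu ->
  improvable eps nu A B1 -> improvable eps nu A B2 ->
  improvable eps nu A (B1 `|` B2).
Proof.
move=> snu [k1 s1 [rho1 [st1 le1 gain1]]] [k2 s2 [rho2 [st2 le2 gain2]]].
split; [exact: known_atU|by move=> w [/s1|/s2]|].
exists (fun w => if w \in B1 then rho1 w else rho2 w); split.
- exact: (stopping_glue hF snu).
- by move=> w; case: ifP.
move=> B' kB' sB'.
have [m1 mB'] := (known_at_measurable hF k1, known_at_measurable hF kB').
have srho : stopping_time F (fun w => if w \in B1 then rho1 w else rho2 w).
  exact: (stopping_glue hF snu).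
rewrite !(Rintegral_split m1 mB')//; [|exact: stopped_integrableS..].
rewrite (pr_split m1 mB') mulrDr addrACA lerD//.
- rewrite [leRHS](eq_Rintegral P (g := fun w => U (rho1 w) w)).
    apply: gain1 => //; exact: known_atI.
  by move=> w; rewrite inE => -[_ B1w]; rewrite mem_set.
- rewrite [leRHS](eq_Rintegral P (g := fun w => U (rho2 w) w)).
    apply: gain2; first exact: known_atD.
    by move=> w [/sB'[]].
  by move=> w; rewrite inE => -[_ B1w]; rewrite memNset.
Qed.

Lemma improvable_gain eps nu A B : stopping_time F nu -> improvable eps nu A B ->
  exists2 rho, stopping_time F rho &
  \int[P]_w U (nu w) w + eps * pr B <= \int[P]_w U (rho w) w.
Proof.
move=> snu [kB _ [rho [st le gain]]]; have mB := known_at_measurable hF kB.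
have st' : stopping_time F (fun w => if w \in B then rho w else nu w).
  exact: (stopping_glue hF snu).
exists (fun w => if w \in B then rho w else nu w) => //.
rewrite !(Rintegral_split mB measurableT)//; [|exact: stopped_integrable..].
rewrite setTI addrAC lerD//.
- rewrite [leRHS](eq_Rintegral P (g := fun w => U (rho w) w)); first exact: gain.
  by move=> w; rewrite inE => ?; rewrite mem_set.
- rewrite le_eqVlt; apply/orP; left; apply/eqP; apply: eq_Rintegral.
  by move=> w; rewrite inE => -[_ ?]; rewrite memNset.
Qed.

Variables (W : xnat -> Omega -> \bar R) (eps : R).
Hypothesis hW : is_snell_envelope P F U W.
Hypothesis eps0 : 0 < eps.

(** On an event where [nu] is constant, being known at [nu] is being known at the
    value of [nu]. *)
Lemma known_at_eq nu (t : xnat) B : B `<=` [set w | nu w = t] ->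
  known_at F nu B <-> sigma_at F t B.
Proof.
move=> Bt; split=> [/(_ t)|FB s]; first by rewrite setIidl.
have [->|ts] := eqVneq s t; first by rewrite setIidl.
rewrite (_ : _ `&` _ = set0); first by case: (sigma_atP hF s).
by rewrite -subset0 => w [/Bt /= -> e]; move: ts; rewrite e eqxx.
Qed.

(** An event where the envelope at [nu] exceeds [U] by more than [eps] contains
    an improvable event of positive probability: on some non-null part of it
    [nu] is constant, and [snell_continue] applies. *)
Lemma improvable_nonnull nu A D :
    stopping_time F nu -> known_at F nu D -> D `<=` A ->
    (forall w, D w -> (nu w < Infty)%O /\
       ((U (nu w) w + eps)%:E < W (nu w) w)%E) ->
    (0 < P D)%E ->
  exists B, [/\ improvable eps nu A B, B `<=` D & (0 < P B)%E].
Proof.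
move=> snu kD DA Dgt PD.
have [t PDt] : exists t, (0 < P (D `&` [set w | nu w = t]))%E.
  apply: contrapT => noT.
  have PDt t : P (D `&` [set w | nu w = Fin t]) = 0%E.
    apply/eqP; rewrite eq_le measure_ge0 andbT leNgt; apply/negP => PDt.
    by apply: noT; exists (Fin t).
  suff PD0 : P D = 0%E by rewrite PD0 ltxx in PD.
  apply/negligibleP; first exact: known_at_measurable kD.
  apply: (@negligibleS _ _ _ P (\bigcup_n (D `&` [set w | nu w = Fin n]))).
  - move=> w Dw; have [+ _] := Dgt w Dw.
    by case e: (nu w) => [n|] // _; exists n.
  - apply: negligible_bigcup => n; apply/negligibleP; last exact: PDt.
    by apply: sigma_at_measurable (kD (Fin n)).
have [_ eW] := hW.
have tgt w : (D `&` [set w | nu w = t]) w -> ((U t w + eps)%:E < W t w)%E.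
  by case=> Dw /= e; have [_] := Dgt w Dw; rewrite e.
have [B [FB sB PB [rho [srho tle] gain]]] := snell_continue (eW t) (kD t) tgt PDt.
have Bt : B `<=` [set w | nu w = t] by move=> w /sB[].
exists B; split=> //; last by move=> w /sB[].
have kB : known_at F nu B by apply/(known_at_eq Bt).
split=> //; first by move=> w /sB[/DA].
exists (fun w => Order.max (rho w) (nu w)); split.
- exact: stopping_max.
- by move=> w; rewrite le_max lexx orbT.
move=> B' kB' B'B.
have B't : B' `<=` [set w | nu w = t] by move=> w /B'B /Bt.
have := gain B' _ B'B; rewrite -(known_at_eq B't) => /(_ kB').
rewrite (eq_Rintegral P (f := U t) (g := fun w => U (nu w) w)); last first.
  by move=> w /set_mem /B't /= ->.
rewrite (eq_Rintegral P (f := fun w => U (rho w) w)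
  (g := fun w => U (Order.max (rho w) (nu w)) w))//.
by move=> w /set_mem /B't /= ->; rewrite max_l.
Qed.

(** A nearly optimal stopping time rarely stops before the envelope comes
    within [eps] of [U]. *)
Lemma early_stop_bound nu A (delta : R) :
    stopping_time F nu -> known_at F nu A ->
    (forall w, A w -> (nu w < Infty)%O /\
       ((U (nu w) w + eps)%:E < W (nu w) w)%E) ->
    (forall rho, stopping_time F rho ->
       \int[P]_w U (rho w) w <= \int[P]_w U (nu w) w + delta) ->
  pr A <= delta / eps.
Proof.
move=> snu kA Agt opt.
have bound B : improvable eps nu A B -> pr B <= delta / eps.
  move=> /(improvable_gain snu)[rho srho gain].
  rewrite ler_pdivlMr// mulrC.
  by have := le_trans gain (opt rho srho); rewrite lerD2l.
(* Exhaustion: improvable events whose probability approaches the supremum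
   cover [A] up to a null set, since improvable events are stable under unions
   and every non-null part of [A] contains a non-null one. *)
pose E := [set pr B | B in improvable eps nu A].
have supE : has_sup E.
  split; first by exists (pr set0), set0 => //; exact: improvable0.
  by exists (delta / eps) => _ [B iB <-]; exact: bound.
apply: (@le_trans _ _ (sup E)); last first.
  by apply: ge_sup => [|_ [B iB <-]]; [case: supE|exact: bound].
have mA := known_at_measurable hF kA.
have near n : exists B, improvable eps nu A B /\ sup E - n.+1%:R^-1 < pr B.
  have n0 : 0 < n.+1%:R^-1 :> R by rewrite invr_gt0.
  have [_ [B iB <-] lt] := sup_adherent n0 supE.
  by exists B.
have [B /all_and2[iB ltB]] := choice near.
have kB n : known_at F nu (B n) by case: (iB n).
have mB n : measurable (B n) := known_at_measurable hF (kB n).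
have mUB : measurable (\bigcup_n B n) by exact: bigcupT_measurable.
have rest0 : P (A `\` \bigcup_n B n) = 0%E.
  apply/eqP; rewrite eq_le measure_ge0 andbT leNgt; apply/negP => PD.
  have kD : known_at F nu (A `\` \bigcup_n B n).
    by apply: known_atD => //; exact: known_at_bigcup.
  have Dgt w : (A `\` \bigcup_n B n) w ->
      (nu w < Infty)%O /\ ((U (nu w) w + eps)%:E < W (nu w) w)%E.
    by case=> Aw _; exact: Agt.
  have [C [iC sC PC]] := improvable_nonnull snu kD (@subDsetl _ _ _) Dgt PD.
  have mC : measurable C by case: iC => /(known_at_measurable hF).
  have prC n : pr C <= n.+1%:R^-1.
    have : pr (B n `|` C) <= sup E.
      by apply: ub_le_sup; [case: supE|exists (B n `|` C) => //; exact: improvableU].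
    have disj : (B n `|` C) `\` B n = C.
      apply/seteqP; split=> w /=; first by case=> -[].
      by move=> Cw; split; [right|move=> Bw; have [_] := sC w Cw; apply; exists n].
    rewrite (@pr_split (B n))//; last exact: measurableU.
    rewrite setUK disj.
    rewrite -lerBrDl => /le_trans; apply.
    by rewrite lerBlDr -lerBlDl; exact: ltW.
  have pC : 0 < pr C by rewrite -lte_fin prE.
  have [n] := ltr_add_invr pC.
  by rewrite add0r ltNge prC.
pose C n := \big[setU/set0]_(i < n.+1) B i.
have iC n : improvable eps nu A (C n).
  rewrite /C; elim: n.+1 => [|m IHm]; first by rewrite big_ord0; exact: improvable0.
  by rewrite big_ord_recr /=; exact: improvableU.
have mC n : measurable (C n) by case: (iC n) => /(known_at_measurable hF).
have CB : \bigcup_n C n = \bigcup_n B n by rewrite /C bigcup_bigsetU_bigcup.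
have ndC : nondecreasing_seq C.
  by move=> m n mn; apply/subsetPset; exact: (@subset_bigsetU _ B).
have cvC : (P \o C) n @[n --> \oo] --> P (\bigcup_n B n).
  by rewrite -CB; apply: nondecreasing_cvg_mu => //; rewrite CB.
have PA : (P A <= P (\bigcup_n B n))%E.
  have -> : (P A = P (A `\` \bigcup_n B n) + P (A `&` \bigcup_n B n))%E.
    exact: measureDI.
  rewrite rest0 add0e le_measure ?inE//.
  exact: measurableI.
rewrite -lee_fin prE//; apply: le_trans PA _.
have : (limn (P \o C) <= (sup E)%:E)%E.
  apply: lime_le; first by apply/cvg_ex; eexists; exact: cvC.
  apply: nearW => n /=; rewrite -prE// lee_fin.
  by apply: ub_le_sup; [case: supE|exists (C n)].
by rewrite (cvg_lim _ cvC).
Qed.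

Lemma Rintegral_le0_partition (f : Omega -> R) nu C :
    measurable C -> P.-integrable setT (EFin \o f) ->
    (forall t, measurable [set w | nu w = t]) ->
    (forall t, \int[P]_(w in C `&` [set w | nu w = t]) f w <= 0) ->
  \int[P]_(w in C) f w <= 0.
Proof.
move=> mC fi mt le0.
pose A n := C `&` [set w | nu w = if n is m.+1 then Fin m else Infty].
have mA n : measurable (A n) by exact: measurableI.
have CE : C = \bigcup_n A n.
  apply/seteqP; split=> w; last by case=> n _ [].
  by move=> Cw; case e: (nu w) => [n|]; [exists n.+1 => //|exists 0%N => //]; split.
have tA : trivIset setT A.
  apply/trivIsetP => i j _ _ ij; rewrite -subset0 => w [[_ /= e1] [_ /= e2]].
  move: (etrans (esym e1) e2) ij.
  by case: i {e1} => [|i]; case: j {e2} => [|j] //= [->]; rewrite eqxx.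
have mUA : measurable (\bigcup_n A n) by exact: bigcupT_measurable.
have cv : (\sum_(0 <= i < n) induced_charge fi (A i))%E @[n --> \oo] -->
    induced_charge fi (\bigcup_n A n).
  exact: charge_semi_sigma_additive.
rewrite CE -lee_fin fineK; last first.
  by apply: integrable_fin_num => //; exact: (integrableS measurableT).
rewrite -[leLHS](cvg_lim _ cv)//; apply: lime_le.
  by apply/cvg_ex; eexists; exact: cv.
apply: nearW => n; apply: sume_le0 => i _.
rewrite /induced_charge -[leLHS]fineK ?lee_fin//; first exact: le0.
by apply: integrable_fin_num => //; exact: (integrableS measurableT).
Qed.

(** If [sigma] never stops at a finite time where waiting could gain more than
    [eps], and never passes a time at which the envelope is within [eps] of [U],
    then it is [eps]-optimal. *)
Theorem eps_optimal_stopping sigma T :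
    stopping_time F sigma ->
    (forall n nu B, sigma_at F (Fin n) B -> B `<=` [set w | sigma w = Fin n] ->
       stopping_times_from F (Fin n) nu ->
       \int[P]_(w in B) U (nu w) w <= \int[P]_(w in B) U (Fin n) w + eps * pr B) ->
    (forall n w, (Fin n < sigma w)%O ->
       ((U (Fin n) w + eps)%:E < W (Fin n) w)%E) ->
    stopping_time F T ->
  \int[P]_w U (T w) w <= \int[P]_w U (sigma w) w + eps.
Proof.
move=> ssig stop_ok before_ok sT.
have iU nu : stopping_time F nu -> P.-integrable setT (EFin \o stopped nu).
  exact: stopped_integrable.
have Ule nu A : stopping_time F nu -> measurable A ->
    `|\int[P]_(w in A) U (nu w) w| <= \int[P]_(w in A) `|g w|.
  move=> snu mA; have iA := stopped_integrableS snu mA.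
  apply: (le_trans (le_normr_Rintegral mA iA)).
  apply: ae_le_Rintegral => //.
  - exact: (integrable_abse iA).
  - by apply: (integrableS measurableT) => //; exact: (integrable_abse ig).
  - by apply: filterS Ug => w /(_ (nu w)) /le_trans h _; apply: h; exact: ler_norm.
(* [nu] is [delta]-optimal, so it stops before [sigma] on an event [A] of
   probability at most [delta / eps]; [delta] makes the integral of [`|g|] on
   [A] less than [e / 3]. *)
apply/ler_addgt0Pr => e e0.
have e30 : 0 < e / 3 by rewrite divr_gt0.
have [r [r0 small]] := integral_normr_continuous ig e30.
pose delta := Num.min (e / 3) (eps * (r / 2)).
have delta0 : 0 < delta by rewrite lt_min e30/= mulr_gt0// divr_gt0.
pose V := [set \int[P]_w U (nu w) w | nu in stopping_time F].
have supV : has_sup V.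
  split; first by exists (\int[P]_w U (T w) w), T.
  exists (\int[P]_w `|g w|) => _ [nu snu <-].
  exact: le_trans (ler_norm _) (Ule _ _ snu measurableT).
have [_ [nu snu <-] nuV] := sup_adherent delta0 supV.
have opt rho : stopping_time F rho ->
    \int[P]_w U (rho w) w <= \int[P]_w U (nu w) w + delta.
  move=> srho; rewrite -lerBlDr ltW// (le_lt_trans _ nuV)// lerD2r.
  by apply: ub_le_sup; [case: supV|exists rho].
pose A := [set w | (nu w < sigma w)%O].
have kA : known_at F nu A by exact: known_at_lt.
have mA := known_at_measurable hF kA.
have mC : measurable (~` A) by exact: measurableC.
have Agt w : A w -> (nu w < Infty)%O /\ ((U (nu w) w + eps)%:E < W (nu w) w)%E.
  move=> Aw; split; first exact: lt_le_trans Aw (le_Infty _).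
  move: Aw; rewrite /A /=; case: (nu w) => [n|]; first exact: before_ok.
  by rewrite ltNge le_Infty.
have PA : pr A <= r / 2.
  apply: le_trans (early_stop_bound snu kA Agt opt) _.
  by rewrite ler_pdivrMr// mulrC /delta ge_min lexx orbT.
have gA : \int[P]_(w in A) `|g w| < e / 3.
  apply: small => //.
  have PAr : ((pr A)%:E < r%:E)%E.
    by rewrite lte_fin (le_lt_trans PA)// ltr_pdivrMr// mulr_natr mulr2n ltrDr.
  by rewrite (prE mA) in PAr.
(* After [sigma], the stopping time [nu] gains at most [eps]. *)
have late : \int[P]_(w in ~` A) U (nu w) w <=
    \int[P]_(w in ~` A) U (sigma w) w + eps.
  have isig := stopped_integrableS ssig mC.
  have inu := stopped_integrableS snu mC.
  have icst B : measurable B -> P.-integrable B (EFin \o cst eps).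
    by move=> mB; exact: finite_measure_integrable_cst.
  have isum rho B : stopping_time F rho -> measurable B ->
      P.-integrable B (EFin \o (fun w => U (rho w) w + eps)).
    move=> srho mB.
    rewrite (_ : EFin \o _ = (EFin \o stopped rho) \+ (EFin \o cst eps))//.
    by apply: integrableD => //; [exact: stopped_integrableS|exact: icst].
  have intsum rho B : stopping_time F rho -> measurable B ->
      \int[P]_(w in B) (U (rho w) w + eps) =
      \int[P]_(w in B) U (rho w) w + eps * pr B.
    move=> srho mB; rewrite RintegralD//; last exact: icst.
      by rewrite Rintegral_cst.
    exact: stopped_integrableS.
  apply: (@le_trans _ _ (\int[P]_(w in ~` A) U (sigma w) w + eps * pr (~` A))).
    rewrite -intsum// -subr_le0 -RintegralB//; last exact: isum.
    apply: (@Rintegral_le0_partition _ sigma) => //.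
    - rewrite (_ : EFin \o _ = ((EFin \o stopped nu) \-
          (EFin \o (fun w => (U (sigma w) w + eps)%R)))%E)//.
      by apply: integrableB => //; [exact: iU|exact: isum].
    - by move=> t; apply: (sigma_at_measurable hF); exact: stopping_eq.
    move=> t; set B := _ `&` _.
    have FB : sigma_at F t B.
      have -> : B = [set w | sigma w = t] `&` [set w | (t <= nu w)%O].
        apply/seteqP; split=> w /= -[h1 h2]; split=> //=.
          by rewrite -h2 leNgt; apply/negP.
        by move=> Aw; move: h2; rewrite leNgt -h1 => /negP; apply.
      apply: (sigma_algebra_setI (sigma_atP hF t)); first exact: stopping_eq.
      rewrite (_ : [set w | (t <= nu w)%O] =
        [set w | (t < nu w)%O] `|` [set w | nu w = t]).
        apply: (sigma_algebra_setU (sigma_atP hF t)); first exact: stopping_gt.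
        exact: stopping_eq.
      apply/seteqP; split=> w /=.
        by rewrite le_eqVlt => /orP[/eqP ->|]; [right|left].
      by case=> [/ltW|->].
    have mB := sigma_at_measurable hF FB.
    have Bt w : B w -> sigma w = t by case.
    have Bnu w : B w -> (t <= nu w)%O.
      by case=> /negP; rewrite -leNgt => + /= <-.
    rewrite RintegralB//; [|exact: stopped_integrableS|exact: isum].
    rewrite intsum// subr_le0.
    rewrite [X in _ <= X + _](eq_Rintegral P (g := U t)); last first.
      by move=> w /set_mem /Bt ->.
    clearbody B; case: t FB Bt Bnu => [n|] FB Bt Bnu.
      rewrite (eq_Rintegral P (f := stopped nu)
        (g := stopped (fun w => Order.max (nu w) (Fin n)))); last first.
        by move=> w /set_mem /Bnu h /=; rewrite max_l.
      apply: stop_ok => //; split.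
        by apply: stopping_max => //; exact: stopping_cst.
      by move=> w; rewrite le_max lexx orbT.
    rewrite (eq_Rintegral P (f := stopped nu) (g := U Infty)).
      by rewrite lerDl; apply: mulr_ge0; [exact: ltW|exact: fine_ge0].
    move=> w /set_mem /Bnu; case: (nu w) => // n; by rewrite leNgt lt_Infty.
  rewrite lerD2l -[leRHS]mulr1 ler_pM2l// -lee_fin prE//; exact: probability_le1.
have := opt T sT.
rewrite [\int[P]_w U (nu w) w](Rintegral_split mA measurableT)//; last exact: iU.
rewrite [\int[P]_w U (sigma w) w](Rintegral_split mA measurableT)//; last exact: iU.
rewrite setTI setTD.
have nuA := le_trans (ler_norm _) (Ule nu A snu mA).
have sigA := Ule sigma A ssig mA.
rewrite ler_norml in sigA; case/andP: sigA => sigA _.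
have dle : delta <= e / 3 by rewrite /delta ge_min lexx.
move: late nuA sigA gA dle; lra.
Qed.


End OptimalStopping.

(** * The players' stopping times in the scheme *)

Lemma bigminx_le (I : eqType) (r : seq I) (f : I -> xnat) k :
  k \in r -> (\big[Order.min/Infty]_(j <- r) f j <= f k)%O.
Proof.
elim: r => // a r IHr; rewrite inE big_cons ge_min => /orP[/eqP ->|/IHr ->].
  by rewrite lexx.
by rewrite orbT.
Qed.

Lemma bigminx_attained (I : eqType) (r : seq I) (f : I -> xnat) a :
  a \in r -> exists2 k, k \in r & \big[Order.min/Infty]_(j <- r) f j = f k.
Proof.
elim: r a => // b r IHr a _; rewrite big_cons.
case: r IHr => [_|c r IHr].
  by exists b; rewrite ?mem_head// big_nil minEle le_Infty.
have [k kr ->] := IHr c (mem_head _ _).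
rewrite minEle; case: ifP => _; first by exists b; rewrite ?mem_head.
by exists k => //; rewrite inE kr orbT.
Qed.

Lemma xmin_mem (A : set xnat) n : xmin A = Fin n -> A (Fin n).
Proof.
by rewrite /xmin; case: pselect => // h [<-]; case: ex_minnP => m /asboolP.
Qed.

Lemma xmin_le (A : set xnat) n : A (Fin n) -> (xmin A <= Fin n)%O.
Proof.
move=> An; rewrite /xmin; case: pselect => [h|nh].
  by case: ex_minnP => m _; apply; exact/asboolP.
by exfalso; apply: nh; exists n; exact/asboolP.
Qed.

Section Payoff.
Context {d : measure_display} {Omega : measurableType d} {N : nat}.
Variable (S : 'I_N -> Omega -> xnat).

Lemma first_stop_le j w : (first_stop S w <= S j w)%O.
Proof. by rewrite /first_stop; apply: bigminx_le; rewrite mem_index_enum. Qed.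

Lemma first_stop_attained (j : 'I_N) w : exists k, first_stop S w = S k w.
Proof.
have [k _ e] := bigminx_attained (fun j => S j w) (mem_index_enum j).
by exists k.
Qed.

End Payoff.

Section PayoffE.
Context {d : measure_display} {Omega : measurableType d} {R : realType} {N : nat}.
Variable X : 'I_N -> {set 'I_N} -> xnat -> Omega -> R.

(** The payoff is the reward indexed by the set of first stoppers. *)
Lemma payoffE (S : 'I_N -> Omega -> xnat) i w :
  payoff X S i w =
  X i [set j | S j w == first_stop S w]%SET (first_stop S w) w.
Proof.
set I0 := [set j | _]%SET.
have I0P j : (j \in I0) = (S j w == first_stop S w) by rewrite inE.
rewrite /payoff (bigD1 I0) /=; last first.
  have [k e] := first_stop_attained S i w.
  by apply/set0Pn; exists k; rewrite I0P e.
rewrite big1 ?addr0; last first.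
  move=> I /andP[_ neI]; rewrite indicE memNset ?mulr0// => -[h1 h2].
  case/eqP: neI; apply/setP => j; rewrite I0P; apply/idP/eqP => [jI|e].
    exact: h1.
  apply/negPn/negP => jI; have /= := h2 j; rewrite inE jI => /(_ isT).
  by rewrite e ltxx.
rewrite indicE mem_set ?mulr1//; split=> j /=.
  by rewrite I0P => /eqP.
by rewrite inE I0P lt_neqAle first_stop_le andbT eq_sym.
Qed.

End PayoffE.

Section Steps.
Context {N : nat}.
Implicit Types (q l : nat) (i j : 'I_N).

(** The step at which player [i] moves in round [q]. Round [0] consists of the
    initial steps, where all stopping times are infinite. *)
Definition step q i : nat := (N * q + i.+1)%N.

(** For [0 < q], the last step up to [step q i] at which player [j] moves: in
    round [q] for the players up to [i], in the preceding round for the others. *)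
Definition last_step q i j : nat := step (if (j <= i)%N then q else q.-1) j.

Lemma turn_step q i : turn (step q i) i. Proof. by exists q. Qed.

Lemma step_inj q1 q2 i j : step q1 i = step q2 j -> q1 = q2 /\ i = j.
Proof.
rewrite /step !addnS => -[e].
have N0 : (0 < N)%N by exact: leq_trans (ltn_ord i).
have eij : i = j.
  apply/val_inj => /=; rewrite -(modn_small (ltn_ord i)) -(modn_small (ltn_ord j)).
  by rewrite -(modnMDl q1 i N) -(modnMDl q2 j N) (mulnC q1) (mulnC q2) e.
split=> //; apply/eqP; rewrite -(eqn_pmul2l N0) -(eqn_add2r j) -{1}eij.
exact/eqP.
Qed.

Lemma stepS q i : (0 < q)%N -> (step q i - N)%N = step q.-1 i.
Proof. by case: q => // q _; rewrite /step mulnS /=; lia. Qed.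

Lemma step_gt q i : (0 < q)%N -> (N + 1 <= step q i)%N.
Proof. by case: q => // q _; rewrite /step mulnS /=; lia. Qed.

Lemma last_stepP q i l : (0 < q)%N ->
  (step q i - N + 1 <= l <= step q i - 1)%N ->
  exists2 j, j != i & l = last_step q i j.
Proof.
move=> q0 lw; have N0 : (0 < N)%N by exact: leq_trans (ltn_ord i).
have := step_gt i q0; have iN := ltn_ord i => stepgt.
have jN : (l.-1 %% N < N)%N by rewrite ltn_mod.
have := divn_eq l.-1 N; set r := (l.-1 %% N)%N in jN *; set p := (l.-1 %/ N)%N.
move=> dl; pose j := Ordinal jN.
have le : l = step p j by rewrite /step /= mulnC; move: lw; lia.
move: lw stepgt; rewrite le /last_step /step /= => lw stepgt.
have pq : p = q \/ p = q.-1.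
  by nia.
exists j.
  by apply/eqP => e; have /= re := congr1 val e; nia.
case: (leqP j i) => /= rij; nia.
Qed.

Lemma last_step_window q i j : (0 < q)%N -> j != i ->
  (step q i - N + 1 <= last_step q i j <= step q i - 1)%N.
Proof.
case: q => // q _ /eqP ji; have iN := ltn_ord i; have jN := ltn_ord j.
have nij : (j : nat) <> i by move=> e; apply: ji; exact: val_inj.
rewrite /last_step /step mulnS; case: (leqP j i) => /= h; rewrite ?mulnS; lia.
Qed.

Lemma turn_last_step q i j l : (0 < q)%N ->
  (step q i - N + 1 <= l <= step q i - 1)%N -> turn l j -> l = last_step q i j.
Proof.
move=> q0 /(last_stepP q0)[k _ ->] [p e].
by have [_ ->] := step_inj e.
Qed.

Lemma last_stepS q i j : (1 < q)%N ->
  (last_step q i j - N)%N = last_step q.-1 i j.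
Proof.
by case: q => [|[|q]] // _; rewrite /last_step; case: (leqP j i) => _; rewrite stepS.
Qed.

End Steps.

Section Dynamics.
Context {d : measure_display} {Omega : measurableType d} {R : realType}.
Variables (P : probability Omega R) (F : nat -> set (set Omega)).
Variables (N : nat) (hN : (2 <= N)%N) (eps : R).
Variable X : 'I_N -> {set 'I_N} -> xnat -> Omega -> R.
Variables (tau : nat -> Omega -> xnat) (W : nat -> xnat -> Omega -> \bar R).
Hypothesis htau : scheme P X tau F eps W.
Implicit Types (i j : 'I_N) (w : Omega) (q l n : nat).

(** The stopping times held by the players just after step [step q i]. *)
Definition profile q i j : Omega -> xnat := tau (last_step q i j).

(** The candidate of player [i] at step [step q i]: the first time at which the
    envelope is within [eps] of the reward, unless the previous stopping time
    comes earlier. *)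
Definition candidate q i w : xnat :=
  Order.min (scheme_mu X tau eps W (step q i) i w) (tau (step q i - N) w).

Notation th q i := (theta N tau (step q i)).

Lemma profile_self q i : profile q i i = tau (step q i).
Proof. by rewrite /profile /last_step leqnn. Qed.

Lemma theta_le n l w : (n - N + 1 <= l <= n - 1)%N -> (theta N tau n w <= tau l w)%O.
Proof.
move=> lw; rewrite (_ : l = (n - (n - l))%N); last by lia.
by apply: (bigminx_le (fun k => tau (n - k)%N w)); rewrite mem_index_iota; lia.
Qed.

Lemma theta_le_profile q i j w :
  (0 < q)%N -> j != i -> (th q i w <= profile q i j w)%O.
Proof. by move=> q0 ji; apply: theta_le; exact: last_step_window. Qed.

Lemma theta_attained q i w : (0 < q)%N ->
  exists2 j, j != i & th q i w = profile q i j w.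
Proof.
move=> q0; have h1 : 1%N \in index_iota 1 N by rewrite mem_index_iota; lia.
have [k] := bigminx_attained (fun k => tau (step q i - k)%N w) h1.
rewrite mem_index_iota => kN e.
have [|j ji le] := last_stepP (i := i) (l := (step q i - k)%N) q0.
  by have := step_gt i q0; lia.
by exists j => //; rewrite /profile -le -e.
Qed.

Lemma first_setE q i w : (0 < q)%N ->
  first_set N tau (step q i) w =
  [set j | (j != i) && (profile q i j w == th q i w)]%SET.
Proof.
move=> q0; apply/setP => j; rewrite !inE; apply/asboolP/andP.
  case=> l [lw lj e]; have le := turn_last_step q0 lw lj.
  split; last by rewrite /profile -le e.
  have [k ki lk] := last_stepP q0 lw.
  by have [_ ->] := step_inj (etrans (esym le) lk).
case=> ji /eqP e; exists (last_step q i j); split=> //.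
  exact: last_step_window.
exact: turn_step.
Qed.

Lemma first_set_neq0 q i w : (0 < q)%N ->
  first_set N tau (step q i) w != finset.set0.
Proof.
move=> q0; have [j ji e] := theta_attained i w q0.
by apply/set0Pn; exists j; rewrite first_setE// inE ji e eqxx.
Qed.

Lemma first_set_Infty q i w : (0 < q)%N -> th q i w = Infty ->
  (first_set N tau (step q i) w :|: [set i] = [set: 'I_N])%SET.
Proof.
move=> q0 e; rewrite first_setE//; apply/setP => j; rewrite !inE.
case: eqVneq => //= ji; rewrite orbF.
have := theta_le_profile w q0 ji; rewrite e => h.
by apply/eqP/le_anti; rewrite h le_Infty.
Qed.

Lemma tau_initial n w : (1 <= n <= N)%N -> tau n w = Infty.
Proof. by case: htau => h _; exact: h. Qed.

Lemma scheme_snell q i : (0 < q)%N ->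
  is_snell_envelope P F (scheme_U X tau (step q i) i) (W (step q i)).
Proof.
by move=> q0; case: htau => _ /(_ _ _ (step_gt i q0) (turn_step q i))[].
Qed.

Lemma tau_step q i w : (0 < q)%N ->
  tau (step q i) w = if (candidate q i w < th q i w)%O then candidate q i w
                     else tau (step q i - N)%N w.
Proof.
by move=> q0; case: htau => _ /(_ _ _ (step_gt i q0) (turn_step q i))[_ ->].
Qed.

Lemma stepP n : (N < n)%N -> exists q i, (0 < q)%N /\ n = step q i.
Proof.
move=> Nn; have N0 : (0 < N)%N by lia.
have iN : (n.-1 %% N < N)%N by rewrite ltn_mod.
exists (n.-1 %/ N)%N, (Ordinal iN); split; first by rewrite divn_gt0//; lia.
by rewrite /step /= mulnC addnS -divn_eq; lia.
Qed.

Lemma tau_move n w : (N < n)%N ->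
  tau n w = tau (n - N)%N w \/
  ((tau n w < theta N tau n w)%O /\ (tau n w <= tau (n - N)%N w)%O).
Proof.
move=> /stepP[q [i [q0 ->]]]; rewrite tau_step//; case: ifP => lt; [right|by left].
by rewrite lt /candidate ge_min lexx orbT.
Qed.

(** Each player's stopping times are nonincreasing along its moves. *)
Lemma tau_le n w : (N < n)%N -> (tau n w <= tau (n - N)%N w)%O.
Proof. by move=> /(tau_move w)[->|[]]. Qed.

Lemma tau_lt_theta q i w : (0 < q)%N -> (tau (step q i) w < th q i w)%O ->
  tau (step q i) w = candidate q i w.
Proof.
move=> q0; rewrite tau_step//; case: ifP => // /negbT; rewrite -leNgt => le lt.
have : (candidate q i w <= tau (step q i - N) w)%O.
  by rewrite /candidate ge_min lexx orbT.
by move=> /(le_trans le)/le_lt_trans/(_ lt); rewrite ltxx.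
Qed.

Lemma tau_ge_theta q i w : (0 < q)%N -> (th q i w <= tau (step q i) w)%O ->
  (th q i w <= candidate q i w)%O.
Proof.
move=> q0; rewrite tau_step//; case: ifP => [lt|/negbT]; last by rewrite -leNgt.
by rewrite leNgt lt.
Qed.

(** The stopping times of any [N] consecutive steps are pairwise distinct where
    finite: a stopping time changes only to a value strictly below those of the
    other players. Hence two players never stop at the same finite time. *)
Lemma tau_distinct n l w : (1 <= l)%N -> (n - N + 1 <= l <= n - 1)%N ->
  tau n w = tau l w -> tau n w = Infty.
Proof.
elim/ltn_ind: n l => n IHn l l1 lw e.
have [nN|Nn] := leqP n N; first by apply: tau_initial; lia.
have [en|[lt _]] := tau_move w Nn; last first.
  by move: (lt_le_trans lt (theta_le w lw)); rewrite e ltxx.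
by rewrite e; apply: (IHn l _ (n - N)%N); lia || rewrite -e.
Qed.

(** When the mover's previous stopping time precedes those of the others, none
    of the others has moved since. *)
Lemma tau_unmoved n l w : (N < n)%N -> (tau (n - N)%N w < theta N tau n w)%O ->
  (n - N + 1 <= l <= n - 1)%N -> (N < l)%N /\ tau l w = tau (l - N)%N w.
Proof.
move=> Nn lt lw; have Nl : (N < l)%N.
  rewrite ltnNge; apply/negP => lN; move: lt.
  by rewrite tau_initial ?ltNge ?le_Infty//; lia.
split=> //; have [//|[ltl _]] := tau_move w Nl.
have le1 : (theta N tau l w <= tau (n - N)%N w)%O by apply: theta_le; lia.
have le2 := theta_le w lw.
by move: (lt_trans (lt_le_trans ltl le1) (lt_le_trans lt le2)); rewrite ltxx.
Qed.

Lemma theta_unmoved q i w : (0 < q)%N ->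
    (tau (step q i - N)%N w < th q i w)%O ->
  [/\ (1 < q)%N, th q i w = th q.-1 i w &
     first_set N tau (step q i) w = first_set N tau (step q.-1 i) w].
Proof.
move=> q0 lt; have Nn : (N < step q i)%N by have := step_gt i q0; lia.
have unmoved := tau_unmoved Nn lt.
have q1 : (1 < q)%N.
  case: q q0 lt Nn unmoved => [|[|q]] //= _ + _ _.
  rewrite stepS// tau_initial ?ltNge ?le_Infty// /step /= muln0.
  by have := ltn_ord i; lia.
have prE j : j != i -> profile q i j w = profile q.-1 i j w.
  move=> ji; rewrite /profile -last_stepS//.
  by have [] := unmoved _ (last_step_window q0 ji).
have q10 : (0 < q.-1)%N by lia.
have thE : th q i w = th q.-1 i w.
  apply/le_anti/andP; split.
    have [j ji ->] := theta_attained i w q10.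
    by rewrite -prE//; exact: theta_le_profile.
  have [j ji ->] := theta_attained i w q0.
  by rewrite prE//; exact: theta_le_profile.
split=> //; rewrite !first_setE//; apply/setP => j; rewrite !inE thE.
by case: eqVneq => //= ji; rewrite prE.
Qed.

(** The rewards of player [i] then agree with those at its preceding move. *)
Lemma scheme_U_unmoved q i t w : (0 < q)%N ->
    (tau (step q i - N)%N w < th q i w)%O ->
  scheme_U X tau (step q i) i t w = scheme_U X tau (step q.-1 i) i t w.
Proof.
by move=> q0 /(theta_unmoved q0)[_ thE fsE]; rewrite /scheme_U /scheme_Y thE fsE.
Qed.

Lemma scheme_U_late q i (s t : xnat) w :
  (th q i w <= s)%O -> (th q i w <= t)%O ->
  scheme_U X tau (step q i) i s w = scheme_U X tau (step q i) i t w.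
Proof. by rewrite /scheme_U !ltNge => -> ->. Qed.

Lemma scheme_U_candidate q i w : (0 < q)%N ->
  scheme_U X tau (step q i) i (tau (step q i) w) w =
  scheme_U X tau (step q i) i (candidate q i w) w.
Proof.
move=> q0; have [le|lt] := leP (th q i w) (tau (step q i) w).
  by apply: scheme_U_late => //; exact: tau_ge_theta.
by rewrite -tau_lt_theta.
Qed.

(** Payoff of the mover [i] when it plays [T] against the others. *)
Lemma deviation_payoffE q i (T : Omega -> xnat) w : (0 < q)%N ->
  payoff X (deviate (profile q i) i T) i w =
  if (T w < th q i w)%O then X i [set i]%SET (T w) w
  else if T w == th q i w then
    X i (first_set N tau (step q i) w :|: [set i])%SET (th q i w) w
  else X i (first_set N tau (step q i) w) (th q i w) w.
Proof.
move=> q0; set S := deviate _ _ _.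
have Si : S i w = T w by rewrite /S /deviate eqxx.
have Sj j : j != i -> S j w = profile q i j w by rewrite /S /deviate => /negPf ->.
have fsE : first_stop S w = Order.min (T w) (th q i w).
  apply/le_anti/andP; split.
    rewrite le_min -{1}Si first_stop_le /=.
    by have [j ji ->] := theta_attained i w q0; rewrite -Sj// first_stop_le.
  have [k ->] := first_stop_attained S i w.
  have [->|ki] := eqVneq k i; first by rewrite Si ge_min lexx.
  by rewrite Sj// ge_min theta_le_profile// orbT.
rewrite payoffE fsE first_setE//.
have thle j : j != i -> (th q i w <= profile q i j w)%O by exact: theta_le_profile.
case: ltgtP => [lt|gt|e].
- congr X; apply/setP => j; rewrite !inE.
  have [->|ji] := eqVneq j i; first by rewrite Si eqxx.
  by rewrite Sj// gt_eqF// (lt_le_trans lt)// thle.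
- congr X; apply/setP => j; rewrite !inE.
  have [->|ji] /= := eqVneq j i; first by rewrite Si gt_eqF.
  by rewrite Sj.
- rewrite e; congr X; apply/setP => j; rewrite !inE.
  have [->|ji] /= := eqVneq j i; first by rewrite Si e eqxx.
  by rewrite Sj// orbF.
Qed.

(** The reward process bounds the payoff of every deviation: from [theta] on it
    is at least what stopping and what waiting pay. *)
Lemma deviation_payoff_le q i (T : Omega -> xnat) w : (0 < q)%N ->
  payoff X (deviate (profile q i) i T) i w <=
  scheme_U X tau (step q i) i (T w) w.
Proof.
move=> q0; rewrite deviation_payoffE// /scheme_U /scheme_Y.
case: ltgtP => // [gt|e].
  by rewrite (lt_le_trans gt (le_Infty _)) le_max lexx orbT.
have [thI|] := eqVneq (th q i w) Infty; last first.
  by rewrite -lt_Infty => ->; rewrite le_max lexx.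
by rewrite first_set_Infty// thI ltxx.
Qed.

(** The new stopping time of the mover collects the reward of [scheme_U]: it
    never meets those of the others, and Assumption A settles the maximum. *)
Lemma profile_payoffE q i w : (0 < q)%N ->
    (forall i j n, X i [set i; j]%SET (Fin n) w <= X i [set j]%SET (Fin n) w) ->
  payoff X (profile q i) i w = scheme_U X tau (step q i) i (tau (step q i) w) w.
Proof.
move=> q0 hA.
have -> : payoff X (profile q i) i w =
    payoff X (deviate (profile q i) i (tau (step q i))) i w.
  congr (payoff X _ i w); apply/funext => j; rewrite /deviate.
  by case: eqP => // ->; rewrite profile_self.
rewrite deviation_payoffE// /scheme_U /scheme_Y.
have [thI|thf] := eqVneq (th q i w) Infty.
  rewrite thI; case: ltgtP => //; first by rewrite ltNge le_Infty.
  by rewrite first_set_Infty// ltxx.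
have [j ji ej] := theta_attained i w q0.
have distinct k l : (step q i - N + 1 <= l)%N -> (l < k)%N -> (k <= step q i)%N ->
    tau k w = tau l w -> tau k w = Infty.
  move=> h1 h2 h3; apply: tau_distinct; have := step_gt i q0; lia.
case: ltgtP => // [gt|e]; last first.
  exfalso; move/eqP: thf; apply; rewrite -e.
  have := last_step_window q0 ji => lw.
  apply: (distinct _ (last_step q i j)); try lia.
  by rewrite e ej.
have fsj : first_set N tau (step q i) w = [set j]%SET.
  apply/setP => k; rewrite first_setE// !inE.
  apply/andP/eqP => [[ki /eqP ek]|->]; last first.
    by rewrite ji ej eqxx.
  have [lk lj] := (last_step_window q0 ki, last_step_window q0 ji).
  have ekj : tau (last_step q i k) w = tau (last_step q i j) w.
    by rewrite -/(profile q i k w) ek ej.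
  have [l|l|] := ltngtP (last_step q i k) (last_step q i j).
  - exfalso; move/eqP: thf; apply; rewrite ej.
    apply: (distinct _ (last_step q i k)) => //; lia.
  - exfalso; move/eqP: thf; apply; rewrite ej -/(profile q i j w) /profile -ekj.
    apply: (distinct _ (last_step q i j)) => //; lia.
  - by move=> /step_inj[].
rewrite lt_Infty thf fsj finset.setUC max_r//.
by case: (th q i w) thf => // n _; exact: hA.
Qed.

End Dynamics.

(** * Integrability and measurability along the scheme *)

Lemma sigma_algebra_forall {T : Type} (K : countType) (G : set (set T))
    (Q : K -> T -> Prop) :
  sigma_algebra setT G -> (forall k, G [set w | Q k w]) ->
  G [set w | forall k, Q k w].
Proof.
move=> sG GQ; rewrite (_ : [set _ | _] = ~` (\bigcup_n
  (if unpickle n is Some k then ~` [set w | Q k w] else set0))).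
  case: (sG) => G0 GC GU; rewrite -setTD; apply: (GC); apply: GU => n.
  by case: unpickle => [k|] //; rewrite -setTD; exact: GC.
apply/seteqP; split=> w /=.
  by move=> Qw [n _]; case: unpickle => [k /= /(_ (Qw k))|].
move=> nU k; apply: contrapT => nQ; apply: nU.
by exists (pickle k) => //; rewrite pickleK.
Qed.

Section Domination.
Context {d : measure_display} {Omega : measurableType d} {R : realType}.
Variables (P : probability Omega R) (F : nat -> set (set Omega)).
Hypothesis hF : is_filtration F.

(** The supremum over time dominates only where it is finite, hence almost
    surely. *)
Lemma payoff_process_dominated (Z : xnat -> Omega -> R) :
  payoff_process P F Z ->
  exists g : Omega -> R, [/\ P.-integrable setT (EFin \o g),
    forall w, 0 <= g w & {ae P, forall w, forall t, `|Z t w| <= g w}].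
Proof.
move=> [aZ fin]; pose S w := ereal_sup (range (fun t => `|Z t w|%:E)).
(* An enumeration of the times turns the supremum into that of a sequence. *)
pose e n := if n is m.+1 then Fin m else Infty.
have mZ t : measurable_fun setT (Z t).
  exact: (measurable_wrt_fun (sigma_at_measurable hF (t := t)) (aZ t)).
have SE : S = fun w => esups (fun n => `|Z (e n) w|%:E) 0%N.
  apply/funext => w; rewrite /S /esups; congr ereal_sup.
  apply/seteqP; split=> x /=.
    case=> [[n|] _ <-]; first by exists n.+1.
    by exists 0%N.
  by case=> n _ <-; exists (e n).
have mS : measurable_fun setT S.
  rewrite SE; apply: measurable_fun_esups => n.
  by apply/measurable_EFinP; exact: measurableT_comp.
have Sge t w : (`|Z t w|%:E <= S w)%E by apply: ereal_sup_ubound; exists t.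
have S0 w : (0 <= S w)%E by apply: le_trans (Sge Infty w); rewrite lee_fin.
have iS : P.-integrable setT S.
  by apply/integrableP; split=> //; under eq_integral do rewrite gee0_abs//.
exists (fine \o S); split.
- apply: (le_integrable measurableT _ _ iS).
    by apply/measurable_EFinP; exact: measurableT_comp.
  move=> w _ /=; rewrite ger0_norm ?fine_ge0// gee0_abs//.
  by case: (S w) (S0 w) => //= *; exact: leey.
- by move=> w /=; exact: fine_ge0.
- apply: filterS (integrable_ae measurableT iS) => w /(_ I) Sfin t /=.
  by rewrite -lee_fin fineK.
Qed.

Variables (N : nat) (X : 'I_N -> {set 'I_N} -> xnat -> Omega -> R).
Hypothesis hX : forall i I, I != finset.set0 -> payoff_process P F (X i I).

Lemma payoffs_dominated :
  exists2 g : Omega -> R, P.-integrable setT (EFin \o g) &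
    {ae P, forall w, forall i I t, I != finset.set0 -> `|X i I t w| <= g w}.
Proof.
pose K := ('I_N * {set 'I_N})%type.
have dom (p : K) : exists g : Omega -> R, [/\ P.-integrable setT (EFin \o g),
    forall w, 0 <= g w &
    {ae P, forall w, forall t, p.2 != finset.set0 -> `|X p.1 p.2 t w| <= g w}].
  have [I0|I0] := eqVneq p.2 finset.set0.
    exists (cst 0); split=> //; first exact: finite_measure_integrable_cst.
    by apply: aeW => w t /eqP[].
  have [g [ig g0 ae]] := payoff_process_dominated (hX p.1 I0).
  by exists g; split=> //; apply: filterS ae => w h t _.
have [g /all_and3[ig g0 gae]] := choice dom.
exists (fun w => \sum_p g p w).
  rewrite (_ : EFin \o _ = fun w => (\sum_p (EFin \o g p) w)%E).
    exact: integrable_sum.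
  by apply/funext => w /=; rewrite sumEFin.
have : {ae P, forall w, forall p : K, forall t,
    p.2 != finset.set0 -> `|X p.1 p.2 t w| <= g p w}.
  exact: filter_forall.
apply: filterS => w h i I t I0; apply: le_trans (h (i, I) t I0) _.
by rewrite (bigD1 (i, I))//= lerDl sumr_ge0.
Qed.

End Domination.

Lemma stopping_bigmin {d : measure_display} {Omega : measurableType d}
    (F : nat -> set (set Omega)) (I : eqType) (r : seq I) (f : I -> Omega -> xnat) :
  is_filtration F -> (forall k, k \in r -> stopping_time F (f k)) ->
  stopping_time F (fun w => \big[Order.min/Infty]_(k <- r) f k w).
Proof.
move=> hF; elim: r => [|k r IHr] sf.
  rewrite (_ : (fun _ => _) = fun=> Infty); first exact: stopping_cst.
  by apply/funext => w; rewrite big_nil.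
rewrite (_ : (fun _ => _) =
    fun w => Order.min (f k w) (\big[Order.min/Infty]_(k <- r) f k w)).
  apply: stopping_min => //; first by apply: sf; rewrite mem_head.
  by apply: IHr => l lr; apply: sf; rewrite inE lr orbT.
by apply/funext => w; rewrite big_cons.
Qed.

Section SchemeMeasurability.
Context {d : measure_display} {Omega : measurableType d} {R : realType}.
Variables (P : probability Omega R) (F : nat -> set (set Omega)).
Hypothesis hF : is_filtration F.
Variables (N : nat) (hN : (2 <= N)%N) (eps : R).
Variable X : 'I_N -> {set 'I_N} -> xnat -> Omega -> R.
Hypothesis hX : forall i I, I != finset.set0 -> payoff_process P F (X i I).
Variables (tau : nat -> Omega -> xnat) (W : nat -> xnat -> Omega -> \bar R).
Hypothesis htau : scheme P X tau F eps W.
Implicit Types (i j : 'I_N) (w : Omega) (q l n : nat).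

Notation th q i := (theta N tau (step q i)).

Lemma scheme_U_dominated q i w (c : R) : (0 < q)%N ->
    (forall i I t, I != finset.set0 -> `|X i I t w| <= c) ->
  forall t, `|scheme_U X tau (step q i) i t w| <= c.
Proof.
move=> q0 Xc t; rewrite /scheme_U /scheme_Y; case: ifP => _.
  by apply: Xc; apply/set0Pn; exists i; rewrite inE.
case: ifP => _; last by apply: Xc; apply/set0Pn; exists i; rewrite inE.
have fs0 := first_set_neq0 hN tau i w q0.
rewrite maxEle; case: ifP => _; apply: Xc => //.
by apply/set0Pn; exists i; rewrite !inE eqxx orbT.
Qed.

Lemma theta_stopping q i : (0 < q)%N ->
    (forall l, (1 <= l < step q i)%N -> stopping_time F (tau l)) ->
  stopping_time F (th q i).
Proof.
move=> q0 st; apply: stopping_bigmin => // k; rewrite mem_index_iota => kN.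
by apply: st; have := step_gt i q0; lia.
Qed.

Lemma scheme_U_adapted q i : (0 < q)%N ->
    (forall l, (1 <= l < step q i)%N -> stopping_time F (tau l)) ->
  adapted F (scheme_U X tau (step q i) i).
Proof.
move=> q0 st t; have sG := sigma_atP hF t.
have sth := theta_stopping q0 st.
(* At time [t] the reward is a function of whether [t < theta] and, if not, of
   the value of [theta] and the set of first stoppers: countably many cases,
   each of them decided by time [t]. *)
pose K := option (option nat * {set 'I_N}).
pose k w : K := if (t < th q i w)%O then None
  else Some (option_of_xnat (th q i w), first_set N tau (step q i) w).
pose h (x : K) w := if x is Some (a, A) then
    let s := xnat_of_option a in
    if [&& (s <= t)%O & A != finset.set0] then
      if (s < Infty)%O then Num.max (X i (A :|: [set i])%SET s w) (X i A s w)
      else X i [set: 'I_N]%SET Infty w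
    else 0
  else X i [set i]%SET t w.
have -> : scheme_U X tau (step q i) i t = fun w => h (k w) w.
  apply/funext => w; rewrite /scheme_U /scheme_Y /k; case: ifP => //.
  move=> /negbT; rewrite -leNgt /h option_of_xnatK => ->.
  by rewrite first_set_neq0.
have X_wrt I (s : xnat) : (s <= t)%O -> I != finset.set0 ->
    measurable_wrt (sigma_at F t) (X i I s).
  move=> st' I0 B mB; apply: (sigma_at_le hF st').
  by case: (hX i I0) => aX _; exact: aX.
apply: (measurable_wrt_glue sG) => [x|x]; case: x => [[a I]|] /=; last first.
- by apply: X_wrt => //; apply/set0Pn; exists i; rewrite inE.
- have m0 : measurable_wrt (sigma_at F t) (fun=> 0 : R).
    by apply/(measurable_wrtP _ sG).
  rewrite /h; case leat: (_ && _) => //; case/andP: leat => leat I0.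
  have iI : (I :|: [set i])%SET != finset.set0.
    by apply/set0Pn; exists i; rewrite !inE eqxx orbT.
  case aI: (_ < _)%O.
    apply/(measurable_wrtP _ sG)/measurable_maxr; apply/(measurable_wrtP _ sG);
      exact: X_wrt.
  have oE : xnat_of_option a = Infty.
    by move/negbT: aI; rewrite lt_Infty negbK => /eqP.
  apply: X_wrt; first by rewrite -oE.
  by apply/set0Pn; exists i; rewrite inE.
- rewrite (_ : [set w | k w = None] = [set w | (t < th q i w)%O]).
    exact: stopping_gt.
  by apply/seteqP; split=> w /=; rewrite /k; case: ifP.
- pose s := xnat_of_option a.
  have [st'|ts] := leP s t; last first.
    rewrite (_ : [set w | _] = set0); first by case: sG.
    rewrite -subset0 => w /=; rewrite /k; case: ifP => // /negbT; rewrite -leNgt.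
    move=> le [ea _]; have e : th q i w = s by rewrite /s -ea option_of_xnatK.
    by move: ts; rewrite -e ltNge le.
  rewrite (_ : [set w | _] = [set w | th q i w = s] `&`
    [set w | forall j, (j != i) && (profile tau q i j w == s) = (j \in I)]).
    apply: (sigma_at_le hF st').
    apply: (sigma_algebra_setI (sigma_atP hF s)); first exact: stopping_eq.
    apply: (sigma_algebra_forall (sigma_atP hF s)) => j.
    have [->|ji] /= := eqVneq j i.
      rewrite (_ : [set _ | _] = [set _ | (i \notin I)]); first exact: sigma_at_bool.
      by apply/seteqP; split=> w /=; case: (i \in I).
    have lw := last_step_window q0 ji.
    have sp : stopping_time F (profile tau q i j).
      by apply: st; have := step_gt i q0; lia.
    case: (j \in I).
      rewrite (_ : [set _ | _] = [set w | profile tau q i j w = s]).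
        exact: stopping_eq.
      by apply/seteqP; split=> w /= /eqP.
    rewrite (_ : [set _ | _] = ~` [set w | profile tau q i j w = s]).
      by apply: (sigma_algebra_setC (sigma_atP hF s)); exact: stopping_eq.
    by apply/seteqP; split=> w /=; [move=> /negbT/eqP|move/eqP/negbTE].
  apply/seteqP; split=> w /=; rewrite /k.
    case: ifP => // /negbT; rewrite -leNgt => le [ea eI].
    have e : th q i w = s by rewrite /s -ea option_of_xnatK.
    by split=> // j; rewrite -eI first_setE// inE e.
  case=> e eI; rewrite e ltNge st' /=; congr (Some (_, _)).
    by rewrite /s; case: a {s st' e eI}.
  by apply/setP => j; rewrite first_setE// inE e eI.
Qed.

Lemma scheme_mu_stopping q i : adapted F (scheme_U X tau (step q i) i) ->
  adapted F (W (step q i)) -> stopping_time F (scheme_mu X tau eps W (step q i) i).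
Proof.
move=> aU aW n; have sG := filtration_sigma_algebra hF n.
rewrite (_ : [set _ | _] = \bigcup_(m in [set m | (m <= n)%N])
  [set w | (W (step q i) (Fin m) w <=
            (scheme_U X tau (step q i) i (Fin m) w + eps)%:E)%E]).
  apply: sigma_algebra_bigcupW => // m /= mn.
  apply: (filtration_nondecreasing hF mn).
  have sGm := filtration_sigma_algebra hF m.
  apply: (measurable_wrt_lee sGm); first exact: (aW (Fin m)).
  apply/(measurable_wrtP _ sGm)/measurable_EFinP/measurable_funD => //.
  by apply/(measurable_wrtP _ sGm); exact: (aU (Fin m)).
apply/seteqP; split=> w /=; rewrite /scheme_mu.
  case e: (xmin _) => [m|] // mn; exists m => //.
  exact: (xmin_mem e).
case=> m mn h; apply: (@le_trans _ _ (Fin m)) => //.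
exact: xmin_le.
Qed.

Lemma tau_stopping n : (1 <= n)%N -> stopping_time F (tau n).
Proof.
elim/ltn_ind: n => n IHn n1.
have [nN|Nn] := leqP n N.
  rewrite (_ : tau n = fun=> Infty); first exact: stopping_cst.
  by apply/funext => w; rewrite (tau_initial htau)// n1.
have [q [i [q0 en]]] := stepP hN Nn.
have st l : (1 <= l < step q i)%N -> stopping_time F (tau l).
  by rewrite -en => /andP[l1 ln]; exact: IHn.
have sprev : stopping_time F (tau (step q i - N)).
  by apply: st; have := step_gt i q0; lia.
have [aW _] := scheme_snell htau i q0.
have smu := scheme_mu_stopping (scheme_U_adapted q0 st) aW.
have scand : stopping_time F (candidate eps X tau W q i) by exact: stopping_min.
rewrite en (_ : tau (step q i) = fun w =>
  if w \in [set w | (candidate eps X tau W q i w < th q i w)%O]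
  then candidate eps X tau W q i w else tau (step q i - N)%N w).
  apply: (stopping_glue hF scand scand sprev) => //.
    by move=> w; rewrite /candidate ge_min lexx orbT.
  by apply: known_at_lt => //; exact: theta_stopping.
apply/funext => w; rewrite (tau_step htau)//.
by case: ifP => h; [rewrite mem_set|rewrite memNset//= h].
Qed.

Lemma candidate_stopping q i : (0 < q)%N ->
  stopping_time F (candidate eps X tau W q i).
Proof.
move=> q0; have [aW _] := scheme_snell htau i q0.
have st l : (1 <= l < step q i)%N -> stopping_time F (tau l).
  by case/andP=> l1 _; exact: tau_stopping.
have smu := scheme_mu_stopping (scheme_U_adapted q0 st) aW.
have sprev : stopping_time F (tau (step q i - N)).
  by apply: st; have := step_gt i q0; lia.
exact: stopping_min.
Qed.

End SchemeMeasurability.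

(** * Best responses and the passage to the limit *)

Section PayoffIntegrability.
Context {d : measure_display} {Omega : measurableType d} {R : realType}.
Variables (P : probability Omega R) (F : nat -> set (set Omega)).
Hypothesis hF : is_filtration F.
Variables (N : nat) (X : 'I_N -> {set 'I_N} -> xnat -> Omega -> R).
Hypothesis hX : forall i I, I != finset.set0 -> payoff_process P F (X i I).
Implicit Types (S : 'I_N -> Omega -> xnat).

Lemma first_stop_stopping S :
  (forall j, stopping_time F (S j)) -> stopping_time F (first_stop S).
Proof. by move=> sS; exact: (stopping_bigmin (f := S)). Qed.

Lemma payoff_measurable S i :
  (forall j, stopping_time F (S j)) -> measurable_fun setT (payoff X S i).
Proof.
move=> sS; have sfs := first_stop_stopping sS.
have mlt j : measurable [set w | (first_stop S w < S j w)%O].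
  by apply: (known_at_measurable hF); exact: (known_at_lt hF sfs (sS j)).
have meq j : measurable [set w | S j w = first_stop S w].
  rewrite (_ : [set _ | _] = ~` [set w | (first_stop S w < S j w)%O]).
    exact: measurableC.
  apply/seteqP; split=> w /=; first by move=> ->; rewrite ltxx.
  move=> /negP; rewrite -leNgt => le; apply/le_anti; rewrite le.
  exact: first_stop_le.
rewrite (_ : payoff X S i = fun w => \sum_(I : {set 'I_N})
    (if I != finset.set0 then X i I (first_stop S w) w * \1_(stopped_by S I) w
     else 0)); last by apply/funext => w; rewrite /payoff big_mkcond.
apply: measurable_sum => I; case: (boolP (I != finset.set0)) => // I0.
apply: measurable_funM.
  by apply: (stopped_measurable hF) => //; case: (hX i I0).
apply: measurable_indic.
rewrite (_ : stopped_by S I = [set w | forall j,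
    if j \in I then S j w = first_stop S w else (first_stop S w < S j w)%O]).
  apply: (sigma_algebra_forall (@sigma_algebra_measurable _ Omega)) => j.
  by case: (j \in I).
apply/seteqP; split=> w /=.
  case=> h1 h2 j; case: ifP => [jI|/negbT jI]; first exact: h1.
  by apply: h2; rewrite /= inE.
move=> h; split=> j /=; first by move=> jI; have := h j; rewrite jI.
by rewrite inE => /negbTE jI; have := h j; rewrite jI.
Qed.

Lemma payoff_dominated S i w (c : R) :
    (forall i I t, I != finset.set0 -> `|X i I t w| <= c) ->
  `|payoff X S i w| <= c.
Proof.
move=> Xc; rewrite payoffE; apply: Xc.
have [k e] := first_stop_attained S i w.
by apply/set0Pn; exists k; rewrite inE e.
Qed.

Lemma payoff_integrable S i : (forall j, stopping_time F (S j)) ->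
  P.-integrable setT (EFin \o payoff X S i).
Proof.
move=> sS; have [g ig Xg] := payoffs_dominated hF hX.
have mp := payoff_measurable i sS.
apply/integrableP; split; first exact/measurable_EFinP.
case/integrableP: (ig) => mg; apply: le_lt_trans.
apply: ae_ge0_le_integral => //.
- by apply: measurableT_comp => //; exact/measurable_EFinP.
- exact: measurableT_comp.
- apply: filterS Xg => w Xw _ /=; rewrite lee_fin.
  by apply: le_trans (ler_norm (g w)); exact: payoff_dominated.
Qed.

Lemma deviate_stopping S i T : (forall j, stopping_time F (S j)) ->
  stopping_time F T -> forall j, stopping_time F (deviate S i T j).
Proof. by move=> sS sT j; rewrite /deviate; case: ifP. Qed.

End PayoffIntegrability.

Section BestResponse.
Context {d : measure_display} {Omega : measurableType d} {R : realType}.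
Variables (P : probability Omega R) (F : nat -> set (set Omega)).
Hypothesis hF : is_filtration F.
Variables (N : nat) (hN : (2 <= N)%N) (eps : R) (heps : 0 < eps).
Variable X : 'I_N -> {set 'I_N} -> xnat -> Omega -> R.
Hypothesis hX : forall i I, I != finset.set0 -> payoff_process P F (X i I).
Hypothesis hA : assumption_A P X.
Variables (tau : nat -> Omega -> xnat) (W : nat -> xnat -> Omega -> \bar R).
Hypothesis htau : scheme P X tau F eps W.
Implicit Types (i j : 'I_N) (w : Omega) (q l n : nat).

Notation th q i := (theta N tau (step q i)).
Notation U q i := (scheme_U X tau (step q i) i).
Notation cand q i := (candidate eps X tau W q i).

Let tau_st l : (1 <= l)%N -> stopping_time F (tau l).
Proof. by move=> l1; exact: (tau_stopping hF hN hX htau). Qed.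

Lemma profile_stopping q i j : stopping_time F (profile tau q i j).
Proof. by apply: tau_st; rewrite /last_step /step addnS. Qed.

Let aU q i : (0 < q)%N -> adapted F (U q i).
Proof.
by move=> q0; apply: (scheme_U_adapted hF hN hX) => // l /andP[l1 _]; exact: tau_st.
Qed.

Let Udom q i (g : Omega -> R) : (0 < q)%N ->
  {ae P, forall w, forall i I t, I != finset.set0 -> `|X i I t w| <= g w} ->
  {ae P, forall w, forall t, `|U q i t w| <= g w}.
Proof. by move=> q0; apply: filterS => w Xw; exact: scheme_U_dominated. Qed.

(** Stopping at the candidate costs at most [eps]. Either the envelope is then
    within [eps] of the reward, or the candidate is the player's previous
    stopping time. In the latter case, if it precedes the stopping times of the
    others, then the rewards are those of the player's preceding move, and
    induction applies; otherwise the reward no longer depends on time. *)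
Lemma candidate_stop q i : (0 < q)%N ->
  forall n nu B, sigma_at F (Fin n) B -> B `<=` [set w | cand q i w = Fin n] ->
    stopping_times_from F (Fin n) nu ->
  \int[P]_(w in B) U q i (nu w) w <=
  \int[P]_(w in B) U q i (Fin n) w + eps * fine (P B).
Proof.
have [g ig Xg] := payoffs_dominated hF hX.
elim: q => // q IHq q0 n nu B FB Bn snu; have [snu1 nle] := snu.
have sG : sigma_algebra setT (sigma_at F (Fin n)) := sigma_atP hF (Fin n).
have aUq : adapted F (U q.+1 i) by exact: aU.
have Uq : {ae P, forall w, forall t, `|U q.+1 i t w| <= g w} by exact: Udom.
have hW := scheme_snell htau i q0; have [aW eW] := hW.
have sth : stopping_time F (th q.+1 i).
  by apply: theta_stopping => // l /andP[l1 _]; exact: tau_st.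
have scst := stopping_cst hF (Fin n).
have iU rho D : stopping_time F rho -> measurable D ->
    P.-integrable D (EFin \o (fun w => U q.+1 i (rho w) w)).
  by move=> srho mD; exact: (stopped_integrableS hF aUq ig Uq).
pose M := [set w | (W (step q.+1 i) (Fin n) w <= (U q.+1 i (Fin n) w + eps)%:E)%E].
pose L := [set w | (Fin n < th q.+1 i w)%O].
have FM : sigma_at F (Fin n) M.
  apply: (measurable_wrt_lee sG); first exact: (aW (Fin n)).
  apply/(measurable_wrtP _ sG)/measurable_EFinP/measurable_funD => //.
  by apply/(measurable_wrtP _ sG); exact: (aUq (Fin n)).
have FL : sigma_at F (Fin n) L by exact: stopping_gt.
have FBM : sigma_at F (Fin n) (B `\` M) by apply: (sigma_algebra_setD sG).
have FBML : sigma_at F (Fin n) ((B `\` M) `&` L) by apply: (sigma_algebra_setI sG).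
have FBMnL : sigma_at F (Fin n) ((B `\` M) `\` L) by apply: (sigma_algebra_setD sG).
have m A : sigma_at F (Fin n) A -> measurable A := @sigma_at_measurable _ _ _ hF _ _.
rewrite (Rintegral_split (m _ FM) (m _ FB) (iU _ _ snu1 (m _ FB))).
rewrite (Rintegral_split (m _ FM) (m _ FB) (iU _ _ scst (m _ FB))).
rewrite (Rintegral_split (m _ FL) (m _ FBM) (iU _ _ snu1 (m _ FBM))).
rewrite (Rintegral_split (m _ FL) (m _ FBM) (iU _ _ scst (m _ FBM))).
rewrite (pr_split P (m _ FM) (m _ FB)) (pr_split P (m _ FL) (m _ FBM)).
set B1 := B `&` M; set B2 := (B `\` M) `&` L; set B3 := (B `\` M) `\` L.
have FB1 : sigma_at F (Fin n) B1 by apply: (sigma_algebra_setI sG).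
have le1 : \int[P]_(w in B1) U q.+1 i (nu w) w <=
    \int[P]_(w in B1) U q.+1 i (Fin n) w + eps * fine (P B1).
  by apply: (snell_stop hF aUq ig Uq (eW (Fin n))) => // w [].
have le3 : \int[P]_(w in B3) U q.+1 i (nu w) w <=
    \int[P]_(w in B3) U q.+1 i (Fin n) w + eps * fine (P B3).
  rewrite (eq_Rintegral P (f := fun w => U q.+1 i (nu w) w)
    (g := U q.+1 i (Fin n))).
    by rewrite lerDl; apply: mulr_ge0; [exact: ltW|exact: fine_ge0].
  move=> w /set_mem [_ /negP]; rewrite -leNgt => thn.
  by apply: scheme_U_late => //; exact: le_trans (nle w).
have prev w : B2 w -> tau (step q.+1 i - N)%N w = Fin n /\ (Fin n < th q.+1 i w)%O.
  case=> -[Bw nM] Lw; split=> //; have := Bn w Bw; rewrite /= /candidate minEle.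
  case: ifP => // _ muE; exfalso; apply: nM.
  exact: xmin_mem muE.
have le2 : \int[P]_(w in B2) U q.+1 i (nu w) w <=
    \int[P]_(w in B2) U q.+1 i (Fin n) w + eps * fine (P B2).
  have UE (t : Omega -> xnat) : {in B2, (fun w => U q.+1 i (t w) w) =1
      (fun w => U q i (t w) w)}.
    move=> w /set_mem /prev[e lt]; rewrite -e in lt.
    exact: (scheme_U_unmoved hN htau (t w) q0 lt).
  rewrite (eq_Rintegral P (UE nu)) (eq_Rintegral P (UE (fun=> Fin n))).
  have [->|/set0P[w0 B2w0]] := eqVneq B2 set0.
    by rewrite !Rintegral_set0 measure0 mulr0 addr0.
  have unmoved w : B2 w -> (1 < q.+1)%N /\ th q.+1 i w = th q i w.
    move=> /prev[e lt]; rewrite -e in lt.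
    by have [] := theta_unmoved hN htau q0 lt.
  have q1 : (0 < q)%N by have [] := unmoved _ B2w0.
  apply: IHq => // w B2w /=.
  have [_ thE] := unmoved w B2w; have [e lt] := prev w B2w.
  move: e; rewrite stepS//= => e.
  by rewrite -(tau_lt_theta htau) ?e// -thE.
move: le1 le2 le3; lra.
Qed.

(** At the step where player [i] moves, its new stopping time is an
    [eps]-best response to those of the other players. *)
Lemma mover_best_response q i T : (0 < q)%N -> stopping_time F T ->
  \int[P]_w payoff X (deviate (profile tau q i) i T) i w <=
  \int[P]_w payoff X (profile tau q i) i w + eps.
Proof.
move=> q0 sT; have [g ig Xg] := payoffs_dominated hF hX.
have aUq : adapted F (U q i) by exact: aU.
have Uq : {ae P, forall w, forall t, `|U q i t w| <= g w} by exact: Udom.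
have sprof := profile_stopping q i.
have scand := candidate_stopping hF hN hX htau i q0.
have hW := scheme_snell htau i q0.
have iU rho : stopping_time F rho ->
    P.-integrable setT (EFin \o (fun w => U q i (rho w) w)).
  by move=> srho; exact: (stopped_integrable hF aUq ig Uq).
have stau : stopping_time F (tau (step q i)) by rewrite -profile_self.
apply: (@le_trans _ _ (\int[P]_w U q i (T w) w)).
  apply: le_Rintegral => //; [|exact: iU|].
    by apply: (payoff_integrable hF hX); exact: deviate_stopping.
  by move=> w _; exact: deviation_payoff_le.
apply: (le_trans (eps_optimal_stopping hF aUq ig Uq hW heps scand _ _ sT)).
- by move=> n nu B; exact: candidate_stop.
- move=> n w nlt; rewrite ltNge; apply/negP => le.
  move: nlt; rewrite /candidate lt_min => /andP[+ _].
  by rewrite ltNge xmin_le.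
rewrite lerD2r.
have hA' : {ae P, forall w, forall i j n,
    X i [set i; j]%SET (Fin n) w <= X i [set j]%SET (Fin n) w}.
  apply: filter_forall => k; apply: filter_forall => j.
  by apply: ae_foralln => n; exact: hA.
apply: ae_le_Rintegral => //; [exact: iU|exact: (payoff_integrable hF hX)|].
apply: filterS hA' => w Aw _.
by rewrite (profile_payoffE hN htau)// (scheme_U_candidate htau).
Qed.

End BestResponse.

Lemma nonincreasing_eventually (u : nat -> xnat) :
  (forall n, (u n.+1 <= u n)%O) ->
  exists l Q, (forall q, (l <= u q)%O) /\ forall q, (Q <= q)%N -> u q = l.
Proof.
move=> u1; have ule p q : (p <= q)%N -> (u q <= u p)%O.
  elim: q => [|q IHq]; first by rewrite leqn0 => /eqP ->.
  rewrite leq_eqVlt => /orP[/eqP ->//|]; rewrite ltnS => /IHq; exact: le_trans.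
have [ex|nex] := pselect (exists m, `[< exists q, u q = Fin m >]).
  case: (ex_minnP ex) => m /asboolP[Q uQ] minm; exists (Fin m), Q.
  have lem q : (Fin m <= u q)%O.
    by case e: (u q) => [k|] //; apply: minm; apply/asboolP; exists q.
  split=> // q Qq; apply/le_anti; rewrite lem andbT -uQ; exact: ule.
have uI q : u q = Infty.
  case e: (u q) => [k|] //; exfalso; apply: nex.
  by exists k; apply/asboolP; exists q.
by exists Infty, 0%N; split=> q; rewrite uI.
Qed.

Section Limit.
Context {d : measure_display} {Omega : measurableType d} {R : realType}.
Variables (P : probability Omega R) (F : nat -> set (set Omega)).
Hypothesis hF : is_filtration F.
Variables (N : nat) (X : 'I_N -> {set 'I_N} -> xnat -> Omega -> R).
Hypothesis hX : forall i I, I != finset.set0 -> payoff_process P F (X i I).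
Implicit Types (S : 'I_N -> Omega -> xnat).

Lemma eq_payoff S S' i w :
  (forall j, S j w = S' j w) -> payoff X S i w = payoff X S' i w.
Proof.
move=> SS'; have fE : first_stop S w = first_stop S' w.
  by rewrite /first_stop; apply: eq_bigr => j _.
by rewrite !payoffE fE; congr X; apply/setP => j; rewrite !inE SS'.
Qed.

(** At each outcome the stopping times, hence the payoffs, are eventually equal
    to their limits, and dominated convergence applies. *)
Lemma payoff_cvg (S_ : nat -> 'I_N -> Omega -> xnat) S i :
    (forall q j, stopping_time F (S_ q j)) ->
    (forall j, stopping_time F (S j)) ->
    (forall j w, exists Q, forall q, (Q <= q)%N -> S_ q j w = S j w) ->
  (\int[P]_w (payoff X (S_ q) i w)%:E)%E @[q --> \oo] -->
    (\int[P]_w (payoff X S i w)%:E)%E.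
Proof.
move=> sS_ sS cv; have [g ig Xg] := payoffs_dominated hF hX.
have [||||_ _] // := @dominated_convergence _ _ _ P setT measurableT
  (fun q w => (payoff X (S_ q) i w)%:E) (fun w => (payoff X S i w)%:E)
  (EFin \o g) _ _ _ ig.
- by move=> q; apply/measurable_EFinP; exact: (payoff_measurable hF hX).
- by apply/measurable_EFinP; exact: (payoff_measurable hF hX).
- apply: aeW => w _; apply: cvg_near_cst.
  have [Q cvQ] := choice (fun j => cv j w).
  exists (\max_j Q j)%N => // q /= Qq; congr EFin; apply: eq_payoff => j.
  by apply: cvQ; apply: leq_trans Qq; exact: leq_bigmax.
- apply: filterS Xg => w Xw q _ /=; rewrite lee_fin.
  exact: payoff_dominated.
Qed.

Variables (hN : (2 <= N)%N) (eps : R).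
Variables (tau : nat -> Omega -> xnat) (W : nat -> xnat -> Omega -> \bar R).
Hypothesis htau : scheme P X tau F eps W.

Lemma limit_timeP (j : 'I_N) w : exists Q,
  (forall q, (limit_time tau j w <= tau (step q j) w)%O) /\
  forall q, (Q <= q)%N -> tau (step q j) w = limit_time tau j w.
Proof.
have [|l [Q [le eqQ]]] := @nonincreasing_eventually (fun q => tau (step q j) w).
  move=> q; have h := @stepS N q.+1 j isT.
  rewrite -[X in (_ <= tau X w)%O]h; apply: (tau_le hN htau).
  by have := @step_gt N q.+1 j isT; lia.
suff -> : limit_time tau j w = l by exists Q.
apply: cvg_lim; first exact: order_hausdorff.
by apply: cvg_near_cst; exists Q => // q /= /eqQ.
Qed.

Lemma limit_time_stopping (j : 'I_N) : stopping_time F (limit_time tau j).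
Proof.
move=> n; rewrite (_ : [set _ | _] =
    \bigcup_q [set w | (tau (step q j) w <= Fin n)%O]).
  apply: sigma_algebra_bigcupW => [|q _]; first exact: filtration_sigma_algebra.
  by apply: (tau_stopping hF hN hX htau); rewrite /step addnS.
apply/seteqP; split=> w /=; have [Q [le eqQ]] := limit_timeP j w.
  by move=> h; exists Q => //=; rewrite eqQ.
by case=> q _ /=; exact: le_trans.
Qed.

Lemma profile_cvg (i j : 'I_N) w :
  exists Q, forall q, (Q <= q)%N -> profile tau q.+1 i j w = limit_time tau j w.
Proof.
have [Q [_ eqQ]] := limit_timeP j w; exists Q => q Qq.
by rewrite /profile /last_step; case: ifP => _; apply: eqQ => //; exact: leqW.
Qed.

End Limit.

Theorem theorem2 (d : measure_display) (Omega : measurableType d)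
  (R : realType) (P : probability Omega R)
  (F : nat -> set (set Omega)) (hF : is_filtration F)
  (N : nat) (hN : (2 <= N)%N) (eps : R) (heps : 0 < eps)
  (X : 'I_N -> {set 'I_N} -> xnat -> Omega -> R)
  (hX : forall (i : 'I_N) (I : {set 'I_N}), I != finset.set0 ->
     payoff_process P F (X i I))
  (hA : assumption_A P X)
  (tau : nat -> Omega -> xnat) (W : nat -> xnat -> Omega -> \bar R)
  (htau : scheme P X tau F eps W) :
  is_eps_Nash P X F eps (limit_time tau).
Proof.
have slim := limit_time_stopping hF hX hN htau.
have sprof := profile_stopping hF hN hX htau.
split=> // i T sT; rewrite unlock.
have cvT := payoff_cvg hF hX (S_ := fun q => deviate (profile tau q.+1 i) i T)
  (S := deviate (limit_time tau) i T) (i := i).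
have {}cvT := cvT (fun q => deviate_stopping i (sprof q.+1 i) sT)
  (deviate_stopping i slim sT).
have {}cvT : (\int[P]_w (payoff X (deviate (profile tau q.+1 i) i T) i w)%:E)%E
    @[q --> \oo] --> (\int[P]_w (payoff X (deviate (limit_time tau) i T) i w)%:E)%E.
  apply: cvT => j w; rewrite /deviate; case: (j == i); first by exists 0%N.
  exact: (profile_cvg hN htau).
have cvP := payoff_cvg hF hX (i := i) (fun q => sprof q.+1 i) slim
  (fun j w => profile_cvg hN htau i j w).
have fin S : (forall j, stopping_time F (S j)) ->
    (\int[P]_w (payoff X S i w)%:E)%E \is a fin_num.
  by move=> sS; apply: integrable_fin_num => //; exact: (payoff_integrable hF hX).
have cvPe : (\int[P]_w (payoff X (profile tau q.+1 i) i w)%:E + eps%:E)%E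
    @[q --> \oo] --> (\int[P]_w (payoff X (limit_time tau) i w)%:E + eps%:E)%E.
  by apply: cvgeD; [rewrite fin_num_adde_defr// fin|exact: cvP|exact: cvg_cst].
rewrite -(cvg_lim _ cvT)// -(cvg_lim _ cvPe)//; apply: lee_lim.
- by apply/cvg_ex; eexists; exact: cvT.
- by apply/cvg_ex; eexists; exact: cvPe.
apply: nearW => q /=.
have := mover_best_response hF hN heps hX hA htau i (ltn0Sn q) sT.
rewrite -lee_fin EFinD /Rintegral !fineK//; first exact: fin.
by apply: fin; exact: deviate_stopping.
Qed.
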